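(* Let $1<\alpha<2$ and $\tfrac12\le r\le1$, let the diffusivity $K(x)\equiv K>0$ be constant, and let $\beta$, $\rho^{(a,b)}$, $u$, $u_N$ and the semi-norm be as defined in the context. For $j\in\mathbb{N}$ and $0\le\mu\le j$, if $D^jf\in L^2_{\rho^{(\beta+j-1,\alpha-\beta+j-1)}}(0,1)$, then there exists $C>0$ (independent of $N$ and $\alpha$) such that $$\|u-u_N\|_{\rho^{(-(\alpha-\beta+1),-(\beta+1))}}\ \le\ C\,N^{-1}\,(N+1)^{-(\alpha-1)}\,\big(N(N+\alpha-1)\big)^{-\frac j2}\,|f|_{j,\,\rho^{(\beta-1,\alpha-\beta-1)},\,A}.$$ (The parameter $\mu$ does not enter the bound.)
   Context: All functions are real-valued on $(0,1)$; $D$ denotes the derivative in $x$; $\mathbb{N}=\{1,2,\dots\}$. Weights: $\rho^{(a,b)}(x):=(1-x)^a x^b$. For $\omega>0$ on $(0,1)$, $L^2_\omega(0,1)$ is the space of $f$ with $\|f\|_\omega:=\big(\int_0^1\omega(x) f(x)^2\,dx\big)^{1/2}<\infty$. Semi-norm: $|v|_{s,\,\rho^{(a,b)},\,A}:=\|D^sv\|_{\rho^{(a+s,b+s)}}$. Given $1<\alpha<2$ and $r$, the number $\beta$ with $\alpha-1\le\beta\le1$ is determined by $r=\dfrac{\sin(\pi\beta)}{\sin(\pi(\alpha-\beta))+\sin(\pi\beta)}$. Put $k(x):=(1-x)^{\alpha-\beta-1}x^{\beta-1}$. Shifted Jacobi polynomials (for $a,b>-1$): $G_n^{(a,b)}(x):=P_n^{(a,b)}(2x-1)$,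 where $P_n^{(a,b)}(y)=2^{-n}\sum_{m=0}^n\binom{n+a}{m}\binom{n+b}{n-m}(y-1)^{n-m}(y+1)^m$ is the usual Jacobi polynomial. Their norms are $$|\|G_n^{(a,b)}|\|:=\Big(\int_0^1(1-x)^a x^b\,G_n^{(a,b)}(x)^2\,dx\Big)^{1/2}=\Big(\tfrac{1}{2n+a+b+1}\tfrac{\Gamma(n+a+1)\Gamma(n+b+1)}{\Gamma(n+1)\Gamma(n+a+b+1)}\Big)^{1/2}.$$ Constants: $\lambda_n:=\dfrac{\sin(\pi\alpha)}{\sin(\pi(\alpha-\beta))+\sin(\pi\beta)}\dfrac{\Gamma(n+\alpha)}{n!}$ for $n\ge0$, and $\lambda_{-1}:=-(1-r)\Gamma(\alpha)\dfrac{\sin(\pi\alpha)}{\sin(\pi(\alpha-\beta))}$, which equals $-\Gamma(\alpha)\dfrac{\sin(\pi\alpha)}{\sin(\pi(\alpha-\beta))+\sin(\pi\beta)}$ (the latter expression is used when $r=1$). For $f\in L^2_{\rho^{(\beta-1,\alpha-\beta-1)}}(0,1)$ (standing assumption on $f$, needed to define $q$) set $f_i:=\int_0^1\rho^{(\beta-1,\alpha-\beta-1)}(x)f(x)G_i^{(\beta-1,\alpha-\beta-1)}(x)\,dx$ for $i\ge0$, $c_i:=\dfrac{f_{i+1}}{\lambda_i\,|\|G_{i+1}^{(\beta-1,\alpha-\beta-1)}|\|^2}$ for $i\ge-1$, and $$q_N(x):=c_{-1}\,x\,k(x)+\rho^{(\alpha-\beta,\beta)}(x)\sum_{i=0}^{N-1}c_i\,G_i^{(\alpha-\beta,\beta)}(x).$$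 The function $q$ is defined by $q-c_{-1}xk:=\lim_{N\to\infty}(q_N-c_{-1}xk)$, the limit being taken in $L^2_{\rho^{(-(\alpha-\beta),-\beta)}}(0,1)$ (where it exists). The solution $u$ of the fractional diffusion problem $$-D\big(\big(r\,{}_0I_x^{2-\alpha}+(1-r)\,{}_xI_1^{2-\alpha}\big)K\,Du\big)=f\ \text{ on }(0,1),\qquad u(0)=u(1)=0,$$ with ${}_0I_x^{\sigma}w(x)=\frac1{\Gamma(\sigma)}\int_0^x\frac{w(s)}{(x-s)^{1-\sigma}}ds$ and ${}_xI_1^{\sigma}w(x)=\frac1{\Gamma(\sigma)}\int_x^1\frac{w(s)}{(s-x)^{1-\sigma}}ds$, is given by $$u(x)=-\int_0^x\frac{c_{-2}k(s)+q(s)}{K(s)}\,ds,$$ where the constant $c_{-2}$ is determined by $\int_0^1\frac{c_{-2}k(s)+q(s)}{K(s)}ds=0$. Its approximation is $$u_N(x):=-\int_0^x\frac{c_{-2,N}k(s)+q_N(s)}{K(s)}\,ds,$$ where the constant $c_{-2,N}$ is determined by $\int_0^1\frac{c_{-2,N}k(s)+q_N(s)}{K(s)}ds=0$.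
   Formalization: Two corrections: N ≥ 1 with j ≤ N+1 (for smaller N a Jacobi polynomial f of degree N+1 < j makes the right side 0 but u ≠ u_N); and for r = 1/2, C is uniform only over α ≥ α0 for any α0 > 1 fixed beforehand, since the error blows up as α → 1. *)

(* Defs.v *)
From HB Require Import structures.
From mathcomp Require Import all_boot all_order all_algebra.
From mathcomp Require Import all_classical all_reals all_analysis.

Set Implicit Arguments.
Unset Strict Implicit.
Unset Printing Implicit Defensive.

Import Order.TTheory GRing.Theory Num.Theory.
Import numFieldNormedType.Exports.

Local Open Scope classical_set_scope.
Local Open Scope ring_scope.

Section Defs.
Context {R : realType}.
Implicit Types (a b x y z : R) (n m i s j N : nat) (f g h w : R -> R).

Local Notation mu := (@lebesgue_measure R).

Definition Gamma z : R :=
  \int[mu]_(t in `]0, +oo[) (t `^ (z - 1) * expR (- t)).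

Definition unitI : set R := `]0, 1[.

Definition rho a b : R -> R := fun x => (1 - x) `^ a * x `^ b.

(* Extended-real valued: it is +oo exactly when the integral diverges. *)
Definition wnorm w f : \bar R :=
  sqrte (\int[mu]_(x in unitI) (w x * f x ^+ 2)%:E)%E.

Definition L2 w f : Prop := measurable_fun unitI f /\ (wnorm w f < +oo)%E.

(* [h] is the (weak) derivative of [g] on (0,1): [g] is locally absolutely
   continuous there, with almost-everywhere derivative [h]. *)
Definition is_D g h : Prop :=
  locally_integrable unitI h /\
  forall x y, 0 < x -> x <= y -> y < 1 ->
    g y - g x = \int[mu]_(t in `[x, y]) h t.

(* Functions are identified when they agree a.e., hence [F 0] may be any
   representative of [f]. *)
Definition is_Dn s f g : Prop :=
  exists F : nat -> R -> R,
    [/\ {ae mu, forall x, unitI x -> F 0%N x = f x},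
        forall i, (i < s)%N -> is_D (F i) (F i.+1)
      & F s = g].

Definition has_Dn s f : Prop := exists g, is_Dn s f g.

(* A representative of D^s f when it exists (unique up to a.e. equality);
   meaningful only under [has_Dn s f]. *)
Definition Dn s f : R -> R := xget (fun=> 0) [set g | is_Dn s f g].

Definition seminorm s a b f : \bar R :=
  wnorm (rho (a + s%:R) (b + s%:R)) (Dn s f).

Definition gbinom z m : R := (\prod_(i < m) (z - i%:R)) / m`!%:R.

Definition jacobiP n a b y : R :=
  2 ^- n * \sum_(m < n.+1) gbinom (n%:R + a) m * gbinom (n%:R + b) (n - m)
           * (y - 1) ^+ (n - m) * (y + 1) ^+ m.

Definition jacobiG n a b : R -> R := fun x => jacobiP n a b (2 * x - 1).

Definition Gnorm n a b : R :=
  Num.sqrt (\int[mu]_(x in unitI) (rho a b x * jacobiG n a b x ^+ 2)).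

Definition is_beta (alpha r beta : R) : Prop :=
  alpha - 1 <= beta <= 1 /\
  r = sin (pi * beta) / (sin (pi * (alpha - beta)) + sin (pi * beta)).

Section Problem.
Variables (alpha r beta : R).

Definition k : R -> R :=
  fun x => (1 - x) `^ (alpha - beta - 1) * x `^ (beta - 1).

Definition lambda n : R :=
  sin (pi * alpha) / (sin (pi * (alpha - beta)) + sin (pi * beta))
  * (Gamma (n%:R + alpha) / n`!%:R).

(* lambda_{-1}: both expressions agree when r <> 1. *)
Definition lambdaN1 : R :=
  if r == 1
  then - Gamma alpha
       * (sin (pi * alpha) / (sin (pi * (alpha - beta)) + sin (pi * beta)))
  else - (1 - r) * Gamma alpha * (sin (pi * alpha) / sin (pi * (alpha - beta))).

Definition fcoef f i : R :=
  \int[mu]_(x in unitI)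
    (rho (beta - 1) (alpha - beta - 1) x * f x
     * jacobiG i (beta - 1) (alpha - beta - 1) x).

(* c_i for i >= 0 *)
Definition c f i : R :=
  fcoef f i.+1
  / (lambda i * Gnorm i.+1 (beta - 1) (alpha - beta - 1) ^+ 2).

(* c_{-1} *)
Definition cN1 f : R :=
  fcoef f 0 / (lambdaN1 * Gnorm 0 (beta - 1) (alpha - beta - 1) ^+ 2).

Definition qN f N : R -> R := fun x =>
  cN1 f * x * k x
  + rho (alpha - beta) beta x
    * \sum_(i < N) c f i * jacobiG i (alpha - beta) beta x.

(* [q - c_{-1} x k] is the limit of [q_N - c_{-1} x k] in L^2 with weight
   rho^(-(alpha - beta), -beta). *)
Definition is_q f (q : R -> R) : Prop :=
  let W := rho (- (alpha - beta)) (- beta) in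
  let p := fun x => cN1 f * x * k x in
  L2 W (q \- p) /\
  wnorm W ((qN f N \- p) \- (q \- p)) @[N --> \oo] --> 0%E.

(* [c2] is the constant c_{-2} attached to [q] (c_{-2,N} for [q := q_N]). *)
Definition is_cN2 (K q : R -> R) (c2 : R) : Prop :=
  \int[mu]_(s in unitI) ((c2 * k s + q s) / K s) = 0.

Definition primitive (K q : R -> R) (c2 : R) : R -> R := fun x =>
  - \int[mu]_(s in `]0, x[) ((c2 * k s + q s) / K s).

Definition is_solution (K f u : R -> R) : Prop :=
  exists q c2, [/\ is_q f q, is_cN2 K q c2 & u = primitive K q c2].

Definition is_approx (K f : R -> R) N (uN : R -> R) : Prop :=
  exists2 c2, is_cN2 K (qN f N) c2 & uN = primitive K (qN f N) c2.

End Problem.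
End Defs.

(* Main.v *)
(** Write a = alpha - beta and b = beta. Rodrigues' formula and D G_n = (n+a+b+1) G_(n-1)
    (with raised parameters) give, by parts, the orthogonality of the G_n, the
    ratios of their norms, and an expression of the n-th coefficient of f
    through the (n-j)-th coefficient of D^j f; Bessel's inequality for D^j f
    then bounds the tail of the coefficients of f. On the other side the
    constants c_(-2) and c_(-2,N) coincide because q - q_N has mean zero, so
    u - u_N is the limit of the integrals of -(q_M - q_N) / K, which are again
    finite orthogonal sums, and Fatou's lemma transfers the bound. The factor
    (N+1)^(-(alpha-1)) comes from Gamma(i+alpha)/i! >= (i+1)^(alpha-1)/2, and
    uniformity in alpha from
    (lambda_i i!/Gamma(i+alpha))^2 = cos^2 t + (2r-1)^2 sin^2 t, t = pi alpha/2. *)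

Require Import Defs.
From HB Require Import structures.
From mathcomp Require Import all_boot all_order all_algebra.
From mathcomp Require Import all_classical all_reals all_analysis.
From mathcomp Require Import measurable_realfun.
From mathcomp Require Import ring lra.

Import Order.TTheory GRing.Theory Num.Theory.
Import numFieldNormedType.Exports.

Local Open Scope classical_set_scope.
Local Open Scope ring_scope.


(** * The fundamental theorem of calculus on an open interval, with one-sided limits at the ends *)

Section FTC_open.
Context {R : realType}.
Local Notation mu := (@lebesgue_measure R).
Implicit Types (u v A B : R) (w W f : R -> R).

(** [is_D] only gives local absolute continuity inside (0,1): nothing is known of the derivatives of
    f at 0 and 1, so boundary terms cannot be discarded directly. Integration by parts is therefore
    a Fubini argument anchored at 1/2; it is dominated because the tail of [rho a b] beyond t, on
    the side away from 1/2, is at most a multiple of [rho (a+1) (b+1) t]. The same argument carries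
    weighted integrability down from D^j f to f.

    The parameters are swapped between data and solution: f is expanded with (beta-1, alpha-beta-1),
    q with (alpha-beta, beta). Norms with swapped positive parameters coincide, which links the two
    families. Integrating rho G_i divides c_i by i, whence N^-1, and raises the weight; the error
    norm carries the inverse of the raised weight, so the integrated terms are again orthogonal.

    Two hypotheses delimit the range. At r = 1/2 the expression in t reduces to cos^2 t, which tends
    to 0 as alpha tends to 1: hence [alpha0]. And D^j f sees only degrees at least j, while the
    error involves the coefficients of f from degree N+1 on: hence j <= N+1. *)

Lemma FTC_sub_itv w W u v x y :
  {in `]u, v[, forall x : R, is_derive x (1 : R) W (w x)} ->
  {in `]u, v[, continuous w} -> u < x -> x < y -> y < v ->
  (\int[mu]_(t in `[x, y]) (w t)%:E = (W y - W x)%:E)%E.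
Proof.
move=> dW cw ux xy yv.
have sub z : z \in `[x, y] -> z \in `]u, v[.
  by rewrite !in_itv/= => /andP[xz zy]; rewrite (lt_le_trans ux)//= (le_lt_trans zy).
have cW z : z \in `[x, y] -> {for z, continuous W}.
  move=> /sub zuv; apply: differentiable_continuous.
  by apply/derivable1_diffP; have [] := dW _ zuv.
rewrite EFinB (continuous_FTC2 xy (F := W))//.
- by apply: continuous_in_subspaceT => z /set_mem zxy; apply: cw; exact: sub.
- split.
  + move=> z zxy; have [] // := dW z _; apply: sub.
    by move: zxy; rewrite !in_itv/= => /andP[/ltW -> /ltW ->].
  + by apply: cvg_at_right_filter; apply: cW; rewrite in_itv/= lexx ltW.
  + by apply: cvg_at_left_filter; apply: cW; rewrite in_itv/= lexx ltW.
- move=> z zxy; rewrite derive1E; apply: derive_val; apply: dW; apply: sub.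
  by move: zxy; rewrite !in_itv/= => /andP[/ltW -> /ltW ->].
Qed.

(** Monotone convergence along compact subintervals exhausting the open one: thanks to the sign,
    integrability comes out as a conclusion. *)
Lemma ge0_FTC_open w W u v A B : u < v ->
  {in `]u, v[, forall x : R, is_derive x (1 : R) W (w x)} ->
  {in `]u, v[, continuous w} ->
  {in `]u, v[, forall x, 0 <= w x} ->
  W @ u^'+ --> A -> W @ v^'- --> B ->
  (\int[mu]_(t in `]u, v[) (w t)%:E = (B - A)%:E)%E.
Proof.
move=> uv dW cw w0 WA WB.
(* The offset 3 gives 2 e n < v - u already at n = 0, so no interval degenerates. *)
pose e n := (v - u) / n.+3%:R.
have e_gt0 n : 0 < e n by rewrite divr_gt0 ?subr_gt0.
have e2 n : u + e n < v - e n.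
  rewrite -subr_gt0 (_ : _ - _ = (v - u) * (1 - 2 / n.+3%:R)); last by rewrite /e; ring.
  rewrite mulr_gt0 ?subr_gt0// ltr_pdivrMr// mul1r ltr_nat//.
have eW n m : (n <= m)%N -> e m <= e n.
  move=> nm; rewrite /e ler_wpM2l ?subr_ge0 ?(ltW uv)// lef_pV2 ?posrE// ler_nat//.
have ecvg : e n @[n --> \oo] --> 0.
  rewrite -(mulr0 (v - u)); apply: cvgMr => /=.
  have : [sequence @harmonic R (n + 2)%N]_n @ \oo --> (0 : R).
    by rewrite cvg_shiftn; exact: cvg_harmonic.
  by apply: cvg_trans; apply: near_eq_cvg; apply: nearW => n /=; rewrite /harmonic addn2.
pose F n := `[u + e n, v - e n]%classic.
have UF : \bigcup_n F n = `]u, v[%classic.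
  apply/seteqP; split=> x.
    move=> [n _]; rewrite /F /= !in_itv/= => /andP[h1 h2].
    by rewrite (lt_le_trans _ h1) ?ltrDl//= (le_lt_trans h2)// gtrBl.
  rewrite /= in_itv/= => /andP[ux xv].
  have d0 : 0 < Num.min (x - u) (v - x) by rewrite lt_min !subr_gt0 ux.
  have [n _ /(_ n (leqnn n))] := cvgr_lt _ ecvg _ d0.
  rewrite /= lt_min => /andP[h1 h2]; exists n => //.
  by rewrite /F /= in_itv/=; apply/andP; split; lra.
have cvI : (\int[mu]_(x in F i) (w x)%:E)%E @[i --> \oo] -->
           (\int[mu]_(x in \bigcup_i F i) (w x)%:E)%E.
  apply: ge0_nondecreasing_set_cvg_integral.
  - move=> n m nm; apply/subsetPset => x; rewrite /F /= !in_itv/= => /andP[h1 h2].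
    by apply/andP; split; have := eW _ _ nm; lra.
  - by move=> i; exact: measurable_itv.
  - move=> i; apply/measurable_EFinP.
    apply: (@measurable_funS _ _ _ _ `]u, v[%classic) => //.
      by rewrite -UF; exact: bigcup_sup.
    by apply: open_continuous_measurable_fun => //; apply/in_continuous_mksetP.
  - move=> i x Fx; rewrite lee_fin; apply: w0.
    have : (\bigcup_n F n) x by exists i.
    by rewrite UF.
rewrite -UF; apply: (cvg_unique _ cvI) => //.
have -> : (fun n => (\int[mu]_(x in F n) (w x)%:E)%E) =
          (fun n => (W (v - e n) - W (u + e n))%:E).
  apply/funext => n; apply: FTC_sub_itv dW cw _ (e2 n) _.
    by rewrite ltrDl.
  by rewrite gtrBl.
apply: cvg_EFin; first exact: nearW.
apply: cvgB.
  apply: (cvg_at_leftP _ _ _).1 WB _ _; split.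
    by move=> n; rewrite gtrBl.
  by rewrite -{2}(subr0 v); apply: cvgB => //; exact: cvg_cst.
apply: (cvg_at_rightP _ _ _).1 WA _ _; split.
  by move=> n; rewrite ltrDl.
by rewrite -{2}(addr0 u); apply: cvgD => //; exact: cvg_cst.
Qed.
End FTC_open.

Section FTC_open_signed.
Context {R : realType}.
Local Notation mu := (@lebesgue_measure R).
Implicit Types (u v A B : R) (w W f : R -> R).

Lemma integrable_itv_oo_cc f u v :
  mu.-integrable `]u, v[ (EFin \o f) -> mu.-integrable `[u, v] (EFin \o f).
Proof.
move=> /integrableP[mf foo]; apply/integrableP; split.
  exact: emeasurable_fun_itv_cc mf.
have mn : measurable_fun `]u, v[ (abse \o (EFin \o f)) by exact: measurableT_comp.
rewrite -integral_itv_bndo_bndc; last first.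
  by apply/emeasurable_fun_itv_obnd_cbndP.
by rewrite -integral_itv_obnd_cbnd.
Qed.

(** Without a sign, integrability becomes a premise. The integral is cut at the midpoint; each half
    depends continuously on its outer endpoint and is thus a limit of the compact case. *)
Lemma FTC_open w W u v A B : u < v ->
  {in `]u, v[, forall x : R, is_derive x (1 : R) W (w x)} ->
  {in `]u, v[, continuous w} ->
  mu.-integrable `]u, v[ (EFin \o w) ->
  W @ u^'+ --> A -> W @ v^'- --> B ->
  \int[mu]_(t in `]u, v[) w t = B - A.
Proof.
move=> uv dW cw iw WA WB.
have icc := integrable_itv_oo_cc _ _ _ iw.
have iS x y : u <= x -> y <= v -> mu.-integrable `[x, y] (EFin \o w).
  move=> ux yv; apply: integrableS icc => // z /=.
  by rewrite !in_itv/= => /andP[h1 h2]; rewrite (le_trans ux)//= (le_trans h2).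
pose m := (u + v) / 2.
have um : u < m by rewrite /m midf_lt.
have mv : m < v by rewrite /m midf_lt.
pose J x y := \int[mu]_(t in `[x, y]) w t.
have JE x y : u < x -> x < y -> y < v -> J x y = W y - W x.
  by move=> ux xy yv; rewrite /J /Rintegral (FTC_sub_itv _ _ _ _ _ _ dW cw).
have JD x y z : u <= x -> x <= y -> y <= z -> z <= v -> J x z = J x y + J y z.
  move=> ux xy yz zv; rewrite /J -(Rintegral_itv_obnd_cbnd (r := y)); last first.
    by apply: integrableS (iS y z _ zv) => //; [exact: subset_itv_oc_cc|exact: le_trans xy].
  rewrite -(@Rintegral_itvB _ _ (BLeft x) (BRight z) y) ?bnd_simp//.
    by rewrite addrCA subrr addr0.
  exact: iS.
have J1 : J m v = B - W m.
  have h1 := @parameterized_integral_cvg_at_left _ m v w mv (iS m v (ltW um) (lexx v)).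
  apply: (cvg_unique _ h1) => //.
  have : (W x - W m) @[x --> v^'-] --> B - W m by apply: cvgB => //; exact: cvg_cst.
  apply: cvg_trans; apply: near_eq_cvg; near=> x.
  by rewrite -JE.
have J2 : J u m = W m - A.
  have h1 := @parameterized_integral_cvg_left _ u m w um (iS u m (lexx u) (ltW mv)).
  have h2 : (J u m - (W m - W x)) @[x --> u^'+] --> (J u m - (W m - A)).
    by apply: cvgB; [exact: cvg_cst|apply: cvgB => //; exact: cvg_cst].
  apply/eqP; rewrite -subr_eq0; apply/eqP.
  apply: (cvg_unique _ h2) => //.
  apply: cvg_trans (cvg_at_right_filter h1); apply: near_eq_cvg; near=> x.
  by rewrite -JE// (JD u x m)// ?addrK// 1?ltW.
transitivity (J u v).
  rewrite /J -Rintegral_itv_obnd_cbnd.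
    by rewrite Rintegral_itv_bndo_bndc.
  by apply: integrableS icc => //; exact: subset_itv_oc_cc.
by rewrite (JD u m v) ?J1 ?J2 ?lexx ?(ltW um) ?(ltW mv)//; ring.
Unshelve. all: by end_near. Qed.
End FTC_open_signed.

(** * Real powers of x and 1 - x *)

Section powR_limits.
Context {R : realType}.
Implicit Types p x : R.

Lemma powR_continuous p x : 0 < x -> {for x, continuous (fun y : R => y `^ p)}.
Proof.
move=> x0; apply: differentiable_continuous.
by apply/derivable1_diffP; apply: derivable_powR; rewrite in_itv/= x0.
Qed.

Lemma onem_powR_continuous p x : x < 1 -> {for x, continuous (fun y : R => (1 - y) `^ p)}.
Proof.
move=> x1; apply: (@continuous_comp _ _ _ (fun y : R => 1 - y) (fun y => y `^ p)).
  by apply: cvgB; [exact: cvg_cst|exact: cvg_id].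
by apply: powR_continuous; rewrite subr_gt0.
Qed.

Lemma onem_powR_cvg_left p : 0 < p -> (1 - y) `^ p @[y --> (1 : R)^'-] --> (0 : R).
Proof.
move=> p0; apply/cvg_at_leftP => y_ [y1 yc].
apply: ((cvg_at_rightP _ _ _).1 (powR_cvg0 p0) (fun n => 1 - y_ n)); split.
  by move=> n; rewrite subr_gt0.
by rewrite -(subrr (1 : R)); apply: cvgB => //; exact: cvg_cst.
Qed.

Lemma is_derive_onem_powR p x : x < 1 ->
  is_derive x (1 : R) (fun y : R => (1 - y) `^ p) (- (p * (1 - x) `^ (p - 1))).
Proof.
move=> x1.
have h1 : is_derive x (1 : R) (fun y : R => 1 - y) (-1).
  by apply: is_derive_eq; rewrite add0r mul1r.
have h2 : is_derive (1 - x) (1 : R) (fun y => y `^ p) (p * (1 - x) `^ (p - 1)).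
  by apply: is_derive1_powR; rewrite subr_gt0.
have := @is_derive1_comp R (fun y => y `^ p) (fun y : R => 1 - y) x _ _ h2 h1.
by rewrite mulrN1.
Qed.

End powR_limits.

(** * Jacobi coefficients in the basis (1-x)^(n-m) x^m *)

Section jacobi_algebra.
Context {R : realType}.
Implicit Types (a b x z : R) (n m : nat).

Lemma gbinomS z k : gbinom z k.+1 * k.+1%:R = gbinom z k * (z - k%:R).
Proof.
rewrite /gbinom big_ord_recr /= factS natrM.
have h1 : k`!%:R != 0 :> R by rewrite pnatr_eq0 -lt0n fact_gt0.
by field; rewrite h1 -[1 + _]addrC natr1 pnatr_eq0.
Qed.

(** In this basis the factor 2^-n cancels, and D, with or without a weight in front, couples only
    neighbouring monomials. *)
Definition jacobi_coef n a b m : R :=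
  gbinom (n%:R + a) m * gbinom (n%:R + b) (n - m) * (- 1) ^+ (n - m).

Lemma jacobiGE n a b x : jacobiG n a b x =
  \sum_(m < n.+1) jacobi_coef n a b m * ((1 - x) ^+ (n - m) * x ^+ m).
Proof.
rewrite /jacobiG /jacobiP big_distrr /=; apply: eq_bigr => m _.
have -> : 2 * x - 1 - 1 = 2 * (- 1 * (1 - x)) by ring.
have -> : 2 * x - 1 + 1 = 2 * x by ring.
rewrite !exprMn /jacobi_coef.
have <- : 2 ^+ (n - m) * 2 ^+ m = 2 ^+ n :> R by rewrite -exprD subnK// -ltnS.
have h p : (2 : R) ^+ p != 0 by rewrite expf_neq0.
by field; rewrite !h.
Qed.

(** By [gbinomS] both terms share the factor gbinom A m * gbinom B (n-m) * (-1)^(n-m), with A =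
    n+1+a and B = n+1+b; what remains is (A - m) + (B - (n - m)) = n + a + b + 2. *)
Lemma jacobi_coef_deriv n a b m : (m < n.+1)%N ->
  jacobi_coef n.+1 a b m.+1 * m.+1%:R - jacobi_coef n.+1 a b m * (n.+1 - m)%:R
  = (n.+1%:R + a + b + 1) * jacobi_coef n (a + 1) (b + 1) m.
Proof.
rewrite ltnS => mn; rewrite /jacobi_coef subSS (subSn mn).
have -> : n%:R + (a + 1) = n.+1%:R + a by rewrite -natr1; ring.
have -> : n%:R + (b + 1) = n.+1%:R + b by rewrite -natr1; ring.
set A := _ + a; set B := _ + b.
have h1 := gbinomS A m; have h2 := gbinomS B (n - m).
rewrite (_ : _ * m.+1%:R = (gbinom A m.+1 * m.+1%:R) * gbinom B (n - m) * (-1) ^+ (n - m)); last by ring.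
rewrite (_ : _ * (n - m).+1%:R = - (gbinom B (n - m).+1 * (n - m).+1%:R) * gbinom A m * (-1) ^+ (n - m)); last by rewrite exprS; ring.
rewrite h1 h2 natrB// /A /B -natr1; ring.
Qed.

(* Compares the coefficients of (1-x)^(n+1-m) x^m in
   D (rho (a+1) (b+1) G_n) = - (n+1) rho a b G_(n+1). *)
Lemma jacobi_coef_rodrigues n a b m : (m <= n.+1)%N ->
  (if (m <= n)%N then jacobi_coef n (a + 1) (b + 1) m * (b + 1 + m%:R) else 0)
  - (if m is m'.+1 then jacobi_coef n (a + 1) (b + 1) m' * (a + 1 + (n - m')%:R) else 0)
  = - (n.+1%:R * jacobi_coef n.+1 a b m).
Proof.
move=> mn.
have e1 : n%:R + (a + 1) = n.+1%:R + a by rewrite -natr1; ring.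
have e2 : n%:R + (b + 1) = n.+1%:R + b by rewrite -natr1; ring.
rewrite /jacobi_coef e1 e2; set A := _ + a; set B := _ + b.
have E1 : (if (m <= n)%N then
   gbinom A m * gbinom B (n - m) * (-1) ^+ (n - m) * (b + 1 + m%:R) else 0) =
   - (gbinom A m * gbinom B (n.+1 - m) * (-1) ^+ (n.+1 - m)) * (n.+1 - m)%:R.
  case: ifPn => [mn'|]; last by rewrite -ltnNge => nm; rewrite (_ : n.+1 - m = 0)%N ?mulr0//; apply/eqP; rewrite subn_eq0.
  rewrite subSn//; have h := gbinomS B (n - m).
  transitivity ((gbinom B (n - m).+1 * (n - m).+1%:R) * gbinom A m * (-1) ^+ (n - m)).
    by rewrite h natrB// /B -natr1; ring.
  by rewrite exprS; ring.
have E2 : (if m is m'.+1 then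
   gbinom A m' * gbinom B (n - m') * (-1) ^+ (n - m') * (a + 1 + (n - m')%:R) else 0) =
   gbinom A m * gbinom B (n.+1 - m) * (-1) ^+ (n.+1 - m) * m%:R.
  case: m mn {E1} => [|m] mn; first by rewrite mulr0.
  rewrite subSS; transitivity ((gbinom A m.+1 * m.+1%:R) * gbinom B (n - m) * (-1) ^+ (n - m)).
    by rewrite gbinomS natrB// /A -natr1; ring.
  by ring.
by rewrite E1 E2 natrB//; ring.
Qed.
End jacobi_algebra.

(** * Derivatives of Jacobi polynomials, alone and times their weight *)

Section jacobi_calculus.
Context {R : realType}.
Implicit Types (a b x z : R) (n m p q : nat).

Lemma is_derive_sum_fun n (h : nat -> R -> R) (dh : nat -> R) x :
  (forall i, (i < n)%N -> is_derive x (1 : R) (h i) (dh i)) ->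
  is_derive x (1 : R) (fun y => \sum_(i < n) h i y) (\sum_(i < n) dh i).
Proof.
move=> H; have -> : (fun y => \sum_(i < n) h i y) = \sum_(i < n) h i.
  by apply/funext => y; rewrite fct_sumE.
by apply: is_derive_sum => i; exact: H.
Qed.

Lemma is_derive_exprn p x :
  is_derive x (1 : R) (fun y : R => y ^+ p) (p%:R * x ^+ p.-1).
Proof.
have -> : (fun y : R => y ^+ p) = (@idfun R) ^+ p by rewrite exprfctE.
have h := @is_deriveX R _ (@idfun R) p x 1 1 (is_derive_id x 1).
by apply: (@is_derive_eq _ _ _ _ _ _ _ _ h); rewrite /GRing.scale/= mulr1.
Qed.

Lemma is_derive_onemX p x :
  is_derive x (1 : R) (fun y : R => (1 - y) ^+ p) (- (p%:R * (1 - x) ^+ p.-1)).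
Proof.
have h1 : is_derive x (1 : R) (fun y : R => 1 - y) (-1).
  by apply: is_derive_eq; rewrite add0r mul1r.
have := @is_derive1_comp R (fun y => y ^+ p) (fun y : R => 1 - y) x _ _
  (is_derive_exprn p (1 - x)) h1.
by rewrite mulrN1.
Qed.

Lemma is_derive_monom p q x :
  is_derive x (1 : R) (fun y : R => (1 - y) ^+ p * y ^+ q)
    (q%:R * ((1 - x) ^+ p * x ^+ q.-1) - p%:R * ((1 - x) ^+ p.-1 * x ^+ q)).
Proof.
have h1 := is_derive_onemX p x.
have h2 := is_derive_exprn q x.
have h := @is_deriveM R _ (fun y : R => (1 - y) ^+ p) (fun y : R => y ^+ q) x 1 _ _ h1 h2.
by apply: (@is_derive_eq _ _ _ _ _ _ _ _ h); rewrite /GRing.scale/=; ring.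
Qed.

Lemma is_derive_jacobiG n a b x : is_derive x (1 : R) (jacobiG n.+1 a b)
  ((n.+1%:R + a + b + 1) * jacobiG n (a + 1) (b + 1) x).
Proof.
have -> : jacobiG n.+1 a b = fun y => \sum_(m < n.+2)
    jacobi_coef n.+1 a b m * ((1 - y) ^+ (n.+1 - m) * y ^+ m).
  by apply/funext => y; rewrite jacobiGE.
pose dh m := jacobi_coef n.+1 a b m *
  (m%:R * ((1 - x) ^+ (n.+1 - m) * x ^+ m.-1)
   - (n.+1 - m)%:R * ((1 - x) ^+ (n.+1 - m).-1 * x ^+ m)).
have -> : (n.+1%:R + a + b + 1) * jacobiG n (a + 1) (b + 1) x = \sum_(m < n.+2) dh m.
  transitivity (\sum_(m < n.+2) (jacobi_coef n.+1 a b m * m%:R) * ((1 - x) ^+ (n.+1 - m) * x ^+ m.-1)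
    - \sum_(m < n.+2) (jacobi_coef n.+1 a b m * (n.+1 - m)%:R) * ((1 - x) ^+ (n.+1 - m).-1 * x ^+ m)).
    (* The first sum loses its term m = 0 and the second its term m = n+1; after the shift both run
       over the same monomials of degree n. *)
    rewrite big_ord_recl/= mulr0 mul0r add0r [in X in _ - X]big_ord_recr/= subnn mulr0 mul0r addr0.
    rewrite -sumrB jacobiGE big_distrr/=; apply: eq_bigr => m _.
    rewrite mulrA -jacobi_coef_deriv// /bump/= add1n add0n subSS.
    have mn : (m <= n)%N by rewrite -ltnS.
    rewrite subSn//=; set c1 := jacobi_coef _ _ _ _; set c2 := jacobi_coef _ _ _ _.
    by rewrite mulrBl.
  by rewrite -sumrB; apply: eq_bigr => m _; rewrite /dh; ring.
apply: (@is_derive_sum_fun _ (fun m y => jacobi_coef n.+1 a b m * ((1 - y) ^+ (n.+1 - m) * y ^+ m))) => m mn.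
have h := is_derive_monom (n.+1 - m) m x.
exact: is_deriveZ.
Qed.

Lemma jacobiG0 a b : jacobiG 0 a b = cst 1.
Proof.
apply/funext => x; rewrite jacobiGE big_ord1 /jacobi_coef /gbinom !big_ord0 fact0.
by rewrite divr1 !expr0 !mulr1.
Qed.

Lemma jacobiG_continuous n a b : continuous (jacobiG n a b).
Proof.
move=> x; case: n => [|n]; first by rewrite jacobiG0; exact: cvg_cst.
apply: differentiable_continuous; apply/derivable1_diffP.
by have [] := is_derive_jacobiG n a b x.
Qed.

Lemma rho_gt0 a b x : 0 < x -> x < 1 -> 0 < rho a b x.
Proof. by move=> x0 x1; rewrite /rho mulr_gt0// powR_gt0// subr_gt0. Qed.

Lemma rho_ge0 a b x : 0 <= rho a b x.
Proof. by rewrite /rho mulr_ge0// powR_ge0. Qed.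

Lemma gt0_powRD x r s : 0 < x -> x `^ (r + s) = x `^ r * x `^ s.
Proof. by move=> x0; rewrite powRD// (gt_eqF x0) implybT. Qed.

Lemma rhoD a b c d x : 0 < x -> x < 1 -> rho (a + c) (b + d) x = rho a b x * rho c d x.
Proof.
by move=> x0 x1; rewrite /rho !gt0_powRD ?subr_gt0//; ring.
Qed.

Lemma rho11 x : 0 < x -> x < 1 -> rho 1 1 x = (1 - x) * x.
Proof. by move=> x0 x1; rewrite /rho !powRr1 ?subr_ge0 ?ltW. Qed.

Lemma rho_succ a b x : 0 < x -> x < 1 ->
  rho (a + 1) (b + 1) x = rho a b x * ((1 - x) * x).
Proof. by move=> x0 x1; rewrite rhoD// rho11. Qed.

Lemma is_derive_rho_succ a b x : 0 < x -> x < 1 ->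
  is_derive x (1 : R) (rho (a + 1) (b + 1))
    (rho a b x * ((b + 1) * (1 - x) - (a + 1) * x)).
Proof.
move=> x0 x1; have h1 := is_derive_onem_powR (a + 1) x x1.
have h2 := is_derive1_powR (b + 1) x0.
have h := @is_deriveM R _ (fun y : R => (1 - y) `^ (a + 1)) (fun y : R => y `^ (b + 1)) x 1 _ _ h1 h2.
apply: (@is_derive_eq _ _ _ _ _ _ _ _ h); rewrite /GRing.scale/= !addrK /rho.
rewrite !gt0_powRD ?subr_gt0//.
by rewrite !powRr1 ?subr_ge0 ?ltW//; ring.
Qed.

(** Rodrigues' formula for a single derivative. Differentiating the raised weight times a monomial
    of degree n leaves [rho a b] times two neighbouring monomials of degree n+1. *)
Lemma is_derive_rho_jacobiG n a b x : 0 < x -> x < 1 ->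
  is_derive x (1 : R) (fun y => rho (a + 1) (b + 1) y * jacobiG n (a + 1) (b + 1) y)
    (- (n.+1%:R * (rho a b x * jacobiG n.+1 a b x))).
Proof.
move=> x0 x1.
pose cc := jacobi_coef n (a + 1) (b + 1).
have -> : (fun y => rho (a + 1) (b + 1) y * jacobiG n (a + 1) (b + 1) y) =
  fun y => \sum_(m < n.+1) cc m * (rho (a + 1) (b + 1) y * ((1 - y) ^+ (n - m) * y ^+ m)).
  by apply/funext => y; rewrite jacobiGE big_distrr/=; apply: eq_bigr => m _; rewrite /cc; ring.
pose mon p q := (1 - x) ^+ p * x ^+ q.
pose dh m := rho a b x * (cc m * (b + 1 + m%:R) * mon (n.+1 - m)%N m
   - cc m * (a + 1 + (n - m)%:R) * mon (n - m)%N m.+1).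
have -> : - (n.+1%:R * (rho a b x * jacobiG n.+1 a b x)) = \sum_(m < n.+1) dh m.
  rewrite -big_distrr/= sumrB.
  transitivity (rho a b x *
    (\sum_(m < n.+2) (if (m <= n)%N then cc m * (b + 1 + m%:R) else 0) * mon (n.+1 - m)%N m
     - \sum_(m < n.+2) (if (m : nat) is m'.+1 then cc m' * (a + 1 + (n - m')%:R) else 0) * mon (n.+1 - m)%N m)).
    rewrite -sumrB jacobiGE mulrCA -mulrN; congr (_ * _).
    rewrite big_distrr -sumrN/=; apply: eq_bigr => m _.
    by rewrite -mulrBl jacobi_coef_rodrigues -1?ltnS// /mon; ring.
  congr (_ * (_ - _)).
    rewrite big_ord_recr/= ltnn mul0r addr0; apply: eq_bigr => m _.
    by rewrite -ltnS ltn_ord.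
  by rewrite big_ord_recl/= mul0r add0r.
apply: (@is_derive_sum_fun _ (fun m y => cc m * (rho (a + 1) (b + 1) y * ((1 - y) ^+ (n - m) * y ^+ m)))) => m mn.
have h1 := is_derive_monom (n - m) m x; have h2 := is_derive_rho_succ a b x x0 x1.
have h := @is_deriveM R _ (rho (a + 1) (b + 1)) (fun y : R => (1 - y) ^+ (n - m) * y ^+ m) x 1 _ _ h2 h1.
have h' := @is_deriveZ R _ _ _ (cc m) _ _ _ h.
apply: (@is_derive_eq _ _ _ _ _ _ _ _ h'); rewrite /GRing.scale/= /dh rho_succ// /mon.
rewrite subSn//.
(* The truncated predecessor is harmless at exponent 0, where the numerical factor vanishes. *)
have e1 : m%:R * x ^+ m = m%:R * x ^+ m.-1 * x :> R.
  by case: (m) => [|k]; rewrite ?mul0r// -mulrA -exprSr.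
have e2 : (n - m)%:R * (1 - x) ^+ (n - m) = (n - m)%:R * (1 - x) ^+ (n - m).-1 * (1 - x) :> R.
  by case: (n - m)%N => [|k]; rewrite ?mul0r// -mulrA -exprSr.
rewrite !exprS.
transitivity (cc m * rho a b x * ((1 - x) ^+ (n - m) * ((m%:R * x ^+ m.-1 * x) * (1 - x))
  - ((n - m)%:R * (1 - x) ^+ (n - m).-1 * (1 - x)) * x ^+ m * x
  + (1 - x) ^+ (n - m) * x ^+ m * ((b + 1) * (1 - x) - (a + 1) * x))); first by ring.
by rewrite -e1 -e2; ring.
Qed.
End jacobi_calculus.

(** * Integrability and finite sums for real-valued functions *)

Section integrable_real.
Context {R : realType}.
Local Notation mu := (@lebesgue_measure R).
Context {D : set (measurableTypeR R)} (mD : measurable D).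
Implicit Types (f g : R -> R) (k : R).
Local Notation L1 f := (mu.-integrable D (EFin \o f)).

Lemma integrableRD {f g} : L1 f -> L1 g -> L1 (fun x => f x + g x).
Proof. by move=> h1 h2; have := integrableD mD h1 h2; apply. Qed.

Lemma integrableRB {f g} : L1 f -> L1 g -> L1 (fun x => f x - g x).
Proof. by move=> h1 h2; have := integrableB mD h1 h2; apply. Qed.

Lemma integrableRZ k {f} : L1 f -> L1 (fun x => k * f x).
Proof. by move=> h; have := integrableZl mD k h; apply. Qed.

Lemma le_integrableR {f} g : measurable_fun D f ->
  (forall x, D x -> `|f x| <= `|g x|) -> L1 g -> L1 f.
Proof.
move=> mf fg ig; apply: (le_integrable mD) ig; first exact/measurable_EFinP.
by move=> x Dx; rewrite lee_fin; exact: fg.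
Qed.

Lemma integrableR_sum n (F : nat -> R -> R) : (forall i, (i < n)%N -> L1 (F i)) ->
  L1 (fun x => \sum_(i < n) F i x).
Proof.
move=> H; elim: n H => [|n IH] H.
  have -> : (fun x => \sum_(i < 0) F i x) = cst 0 by apply/funext => x; rewrite big_ord0.
  exact: integrable0.
have -> : (fun x => \sum_(i < n.+1) F i x) = fun x => \sum_(i < n) F i x + F n x.
  by apply/funext => x; rewrite big_ord_recr.
by apply: integrableRD; [apply: IH => i ni; apply: H; exact: ltnW|exact: H].
Qed.

Lemma Rintegral_sum n (F : nat -> R -> R) : (forall i, (i < n)%N -> L1 (F i)) ->
  \int[mu]_(x in D) (\sum_(i < n) F i x) = \sum_(i < n) \int[mu]_(x in D) F i x.
Proof.
move=> H; elim: n H => [|n IH] H.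
  by under eq_Rintegral do rewrite big_ord0; rewrite Rintegral_cst// mul0r big_ord0.
under eq_Rintegral do rewrite big_ord_recr/=.
rewrite RintegralD//; last exact: H.
  by rewrite big_ord_recr/= IH// => i ni; apply: H; exact: ltnW.
by apply: integrableR_sum => i ni; apply: H; exact: ltnW.
Qed.

Lemma integrableR_norm f : L1 f -> L1 (fun x => `|f x|).
Proof. exact: integrable_norm. Qed.

Lemma measurable_integrableR {f} : L1 f -> measurable_fun D f.
Proof. by move=> /measurable_int/measurable_EFinP. Qed.

End integrable_real.

Lemma measurable_unitI {R : realType} : measurable (unitI : set (measurableTypeR R)).
Proof. exact: measurable_itv. Qed.
#[global] Hint Resolve measurable_unitI : core.

(** * Integrals and tails of the weights *)

Section rho_integrals.
Context {R : realType}.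
Local Notation mu := (@lebesgue_measure R).
Implicit Types (a b x t : R).

Lemma measurable_onem_powR a D : measurable_fun D (fun x : R => (1 - x) `^ a).
Proof.
apply: measurable_funTS.
apply: (@measurableT_comp _ _ _ _ _ _ (fun y : R => y `^ a) _ (fun x : R => 1 - x)).
  exact: measurable_powR.
exact: measurable_funB.
Qed.

Lemma measurable_rho a b D : measurable_fun D (rho a b : R -> R).
Proof.
apply: measurable_funM; first exact: measurable_onem_powR.
by apply: measurable_funTS; exact: measurable_powR.
Qed.

Lemma integral_onem_powR a t : -1 < a -> 0 <= t -> t < 1 ->
  (\int[mu]_(x in `]t, 1%R[) ((1 - x) `^ a)%:E = ((1 - t) `^ (a + 1) / (a + 1))%:E)%E.
Proof.
move=> a1 t0 t1; have a10 : 0 < a + 1 by lra.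
rewrite (ge0_FTC_open _ (fun y => - (a + 1)^-1 * (1 - y) `^ (a + 1)) _ _
  (- (a + 1)^-1 * (1 - t) `^ (a + 1)) (- (a + 1)^-1 * 0))//.
- by congr _%:E; ring.
- move=> x; rewrite in_itv/= => /andP[_ x1].
  have h := @is_deriveZ R _ _ _ (- (a + 1)^-1) _ _ _ (is_derive_onem_powR (a + 1) x x1).
  apply: (@is_derive_eq _ _ _ _ _ _ _ _ h); rewrite /GRing.scale/= addrK.
  by field; rewrite gt_eqF.
- by move=> x; rewrite in_itv/= => /andP[_ x1]; exact: onem_powR_continuous.
- by move=> x _; exact: powR_ge0.
- apply: cvgMr; apply: cvg_at_right_filter; exact: onem_powR_continuous.
- by apply: cvgMr; exact: onem_powR_cvg_left.
Qed.

Lemma integral_powR b t : -1 < b -> 0 < t ->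
  (\int[mu]_(x in `]0%R, t[) (x `^ b)%:E = (t `^ (b + 1) / (b + 1))%:E)%E.
Proof.
move=> b1 t0; have b10 : 0 < b + 1 by lra.
rewrite (ge0_FTC_open _ (fun y => (b + 1)^-1 * y `^ (b + 1)) _ _
  ((b + 1)^-1 * 0) ((b + 1)^-1 * t `^ (b + 1)))//.
- by congr _%:E; ring.
- move=> x; rewrite in_itv/= => /andP[x0 _].
  have h := @is_deriveZ R _ _ _ ((b + 1)^-1) _ _ _ (is_derive1_powR (b + 1) x0).
  apply: (@is_derive_eq _ _ _ _ _ _ _ _ h); rewrite /GRing.scale/= addrK.
  by field; rewrite gt_eqF.
- by move=> x; rewrite in_itv/= => /andP[x0 _]; exact: powR_continuous.
- by move=> x _; exact: powR_ge0.
- by apply: cvgMr; exact: powR_cvg0.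
- apply: cvgMr; apply: cvg_at_left_filter; exact: powR_continuous.
Qed.

(** The absolute value lets one constant serve exponents of either sign: on each half of (0,1) the
    weight is then comparable to a single power. *)
Lemma powR_half_bounds b x : 2^-1 <= x -> x <= 1 ->
  (2 `^ `|b|)^-1 <= x `^ b /\ x `^ b <= 2 `^ `|b|.
Proof.
move=> x2 x1; have x0 : 0 < x by apply: lt_le_trans x2; rewrite invr_gt0.
have p0 : 0 < 2 `^ `|b| :> R by rewrite powR_gt0.
have p1 : 1 <= 2 `^ `|b| :> R.
  by rewrite -{1}(powRr0 (2 : R)) ler_powR// ler1n.
have q0 : 0 < x `^ `|b| by rewrite powR_gt0.
have q1 : x `^ `|b| <= 1.
  have <- : 1 `^ `|b| = 1 :> R by rewrite powR1.
  by rewrite ge0_ler_powR// nnegrE ltW.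
have q2 : (2 `^ `|b|)^-1 <= x `^ `|b|.
  rewrite -powRN -mulN1r powRrM powR_inv1//.
  by rewrite ge0_ler_powR// nnegrE ?invr_ge0// ltW.
have [b0|b0] := leP 0 b.
  by move: q0 q1 q2; rewrite ger0_norm in p0 p1 *; move=> // q0 q1 q2; split => //; exact: le_trans p1.
have -> : b = - `|b| by rewrite ltr0_norm// opprK.
rewrite normrN normr_id powRN; split.
  by rewrite lef_pV2 ?posrE//; exact: le_trans p1.
by rewrite -[leRHS]invrK lef_pV2 ?posrE ?invr_gt0.
Qed.

(** Near either end one factor of the weight is comparable to a constant, and the other has an
    explicit primitive with exponent raised by one. These are the tails that dominate the
    integration by parts. *)
Lemma rho_tail_bounds a b : -1 < a -> -1 < b -> exists2 C : R, 0 < C & forall t,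
  (2^-1 <= t -> t < 1 ->
    (\int[mu]_(x in `]t, 1%R[) (rho a b x)%:E <= (C * rho (a + 1) (b + 1) t)%:E)%E) /\
  (0 < t -> t <= 2^-1 ->
    (\int[mu]_(x in `]0%R, t[) (rho a b x)%:E <= (C * rho (a + 1) (b + 1) t)%:E)%E).
Proof.
move=> a1 b1; have a10 : 0 < a + 1 by lra.
have b10 : 0 < b + 1 by lra.
pose P (c : R) : R := 2 `^ `|c|.
have P0 c : 0 < P c by rewrite powR_gt0.
(* In C1, P b removes x^b from the integrand, P (b+1) restores t^(b+1) in the bound, and 1/(a+1)
   comes from the primitive; C2 is the mirror image. *)
pose C1 := P b * P (b + 1) / (a + 1); pose C2 := P a * P (a + 1) / (b + 1).
have C10 : 0 < C1 by rewrite divr_gt0// mulr_gt0.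
have C20 : 0 < C2 by rewrite divr_gt0// mulr_gt0.
exists (C1 + C2); first exact: addr_gt0.
move=> t; split=> [t2 t1|t0 t2].
  have t0 : 0 < t by apply: lt_le_trans t2; rewrite invr_gt0.
  apply: (@le_trans _ _ (\int[mu]_(x in `]t, 1%R[) ((P b)%:E * ((1 - x) `^ a)%:E))%E).
    apply: ge0_le_integral => //.
    - by move=> x _; rewrite lee_fin rho_ge0.
    - by apply/measurable_EFinP; exact: measurable_rho.
    - apply/measurable_EFinP; apply: measurable_funM => //.
      exact: measurable_onem_powR.
    - move=> x /=; rewrite in_itv/= => /andP[tx x1].
      rewrite -EFinM lee_fin /rho mulrC ler_wpM2r ?powR_ge0//.
      by have [] := @powR_half_bounds b x (le_trans t2 (ltW tx)) (ltW x1).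
  rewrite ge0_integralZl//.
  - rewrite integral_onem_powR ?(ltW t0)// -EFinM lee_fin.
    have r0 : 0 <= rho (a + 1) (b + 1) t by exact: rho_ge0.
    apply: (@le_trans _ _ (C1 * rho (a + 1) (b + 1) t)); last by rewrite ler_wpM2r// lerDl ltW.
    rewrite /C1 /rho.
    have [h _] := @powR_half_bounds (b + 1) t t2 (ltW t1).
    have -> : P b * P (b + 1) / (a + 1) * ((1 - t) `^ (a + 1) * t `^ (b + 1)) = P b * ((1 - t) `^ (a + 1) / (a + 1)) * (P (b + 1) * t `^ (b + 1)) by ring.
    rewrite ler_peMr//.
      by rewrite mulr_ge0 ?(ltW (P0 _))// divr_ge0 ?powR_ge0// ltW.
    by rewrite -[X in X <= _](@mulfV _ (P (b + 1))) ?gt_eqF// ler_wpM2l// ltW.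
  - by apply/measurable_EFinP; exact: measurable_onem_powR.
  - by move=> x _; rewrite lee_fin powR_ge0.
  - by rewrite lee_fin ltW.
have t1 : t < 1 by apply: (le_lt_trans t2); rewrite invf_lt1// ltr1n.
apply: (@le_trans _ _ (\int[mu]_(x in `]0%R, t[) ((P a)%:E * (x `^ b)%:E))%E).
  apply: ge0_le_integral => //.
  - by move=> x _; rewrite lee_fin rho_ge0.
  - by apply/measurable_EFinP; exact: measurable_rho.
  - apply/measurable_EFinP; apply: measurable_funM => //.
    by apply: measurable_funTS; exact: measurable_powR.
  - move=> x /=; rewrite in_itv/= => /andP[x0 xt].
    rewrite -EFinM lee_fin /rho ler_wpM2r ?powR_ge0//.
    have h1 : 2^-1 <= 1 - x by lra.
    have h2 : 1 - x <= 1 by lra.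
    by have [] := powR_half_bounds a _ h1 h2.
rewrite ge0_integralZl//.
- rewrite integral_powR// -EFinM lee_fin.
  have r0 : 0 <= rho (a + 1) (b + 1) t by exact: rho_ge0.
  apply: (@le_trans _ _ (C2 * rho (a + 1) (b + 1) t)); last by rewrite ler_wpM2r// lerDr ltW.
  rewrite /C2 /rho.
  have [h _] : (P (a + 1))^-1 <= (1 - t) `^ (a + 1) /\ (1 - t) `^ (a + 1) <= P (a + 1).
    by apply: powR_half_bounds; lra.
  have -> : P a * P (a + 1) / (b + 1) * ((1 - t) `^ (a + 1) * t `^ (b + 1)) = P a * (t `^ (b + 1) / (b + 1)) * (P (a + 1) * (1 - t) `^ (a + 1)) by ring.
  rewrite ler_peMr//.
    by rewrite mulr_ge0 ?(ltW (P0 _))// divr_ge0 ?powR_ge0// ltW.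
  by rewrite -[X in X <= _](@mulfV _ (P (a + 1))) ?gt_eqF// ler_wpM2l// ltW.
- by apply/measurable_EFinP; apply: measurable_funTS; exact: measurable_powR.
- by move=> x _; rewrite lee_fin powR_ge0.
- by rewrite lee_fin ltW.
Qed.

Lemma integrable_rho a b : -1 < a -> -1 < b ->
  mu.-integrable unitI (EFin \o (rho a b : R -> R)).
Proof.
move=> a1 b1; pose P (c : R) : R := 2 `^ `|c|.
have P0 c : 0 < P c by rewrite powR_gt0.
have i1 : mu.-integrable unitI (EFin \o (fun x : R => (1 - x) `^ a)).
  apply/integrableP; split.
    by apply/measurable_EFinP; exact: measurable_onem_powR.
  under eq_integral do rewrite gee0_abs ?lee_fin ?powR_ge0//.
  by rewrite integral_onem_powR// ltry.
have i2 : mu.-integrable unitI (EFin \o (fun x : R => x `^ b)).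
  apply/integrableP; split.
    by apply/measurable_EFinP; apply: measurable_funTS; exact: measurable_powR.
  under eq_integral do rewrite gee0_abs ?lee_fin ?powR_ge0//.
  by rewrite integral_powR// ltry.
apply: (le_integrableR measurable_unitI (fun x => P b * (1 - x) `^ a + P a * x `^ b)) => //.
- exact: measurable_rho.
- move=> x; rewrite /unitI/= in_itv/= => /andP[x0 x1].
  rewrite !ger0_norm ?rho_ge0//; last first.
    by rewrite addr_ge0// mulr_ge0 ?powR_ge0// ltW.
  have Pa : 0 <= P a * x `^ b by rewrite mulr_ge0 ?powR_ge0// ltW.
  have Pb : 0 <= P b * (1 - x) `^ a by rewrite mulr_ge0 ?powR_ge0// ltW.
  rewrite /rho; have [x2|x2] := leP 2^-1 x.
    apply: (@le_trans _ _ (P b * (1 - x) `^ a)); last by rewrite lerDl.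
    by rewrite mulrC ler_wpM2r ?powR_ge0//; have [] := powR_half_bounds b _ x2 (ltW x1).
  apply: (@le_trans _ _ (P a * x `^ b)); last by rewrite lerDr.
  have h1 : 2^-1 <= 1 - x by lra.
  have h2 : 1 - x <= 1 by lra.
  by rewrite ler_wpM2r ?powR_ge0//; have [] := powR_half_bounds a _ h1 h2.
- by apply: (integrableRD measurable_unitI); apply: (integrableRZ measurable_unitI).
Qed.
End rho_integrals.

(** * Integration by parts for weak derivatives, by Fubini *)

Section weak_integration_by_parts.
Context {R : realType}.
Local Notation mu := (@lebesgue_measure R).
Local Notation L1 f := (mu.-integrable unitI (EFin \o f)).
Context (g h w V : R -> R).
Hypotheses (Dgh : is_D g h) (iw : L1 w) (iVh : L1 (fun t => V t * h t)).
(** The integral over x of |w x * ker (x, t)| is the tail of |w| beyond t, on the side away from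
    1/2. Bounding it by V makes V |h| a majorant of the sections in t. *)
Hypothesis V_right : forall t, 2^-1 <= t -> t < 1 ->
  (\int[mu]_(x in `]t, 1%R[) `|w x|%:E <= (V t)%:E)%E.
Hypothesis V_left : forall t, 0 < t -> t <= 2^-1 ->
  (\int[mu]_(x in `]0%R, t[) `|w x|%:E <= (V t)%:E)%E.

(* g x - g (1/2) is the integral over t of [ker (x, t) * h t], which turns the
   integration by parts into an application of Fubini's theorem. *)
Let ker (z : R * R) : R :=
  if 2^-1 <= z.2 then (if z.2 < z.1 then 1 else 0)
  else (if z.1 <= z.2 then -1 else 0).

Let F (z : measurableTypeR R * measurableTypeR R) : \bar R :=
  ((w \_ unitI) z.1 * ker z * (h \_ unitI) z.2)%:E.

Let mh : measurable_fun unitI h. Proof. by case: Dgh => -[]. Qed.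

Let mker : measurable_fun [set: measurableTypeR R * measurableTypeR R] ker.
Proof.
apply: measurable_fun_ifT.
- by apply: measurable_fun_ler => //; exact: measurable_snd.
- by apply: measurable_fun_ifT => //; apply: measurable_fun_ltr;
    [exact: measurable_snd|exact: measurable_fst].
- by apply: measurable_fun_ifT => //; apply: measurable_fun_ler;
    [exact: measurable_fst|exact: measurable_snd].
Qed.

Let mw0 : measurable_fun [set: R] (w \_ unitI).
Proof.
by apply/(measurable_restrictT _ _).1; [exact: measurable_itv|exact: measurable_integrableR iw].
Qed.

Let mh0 : measurable_fun [set: R] (h \_ unitI).
Proof. by apply/(measurable_restrictT _ _).1 => //; exact: measurable_itv. Qed.

Let mF : measurable_fun setT F.
Proof.
apply/measurable_EFinP; apply: measurable_funM.
  apply: measurable_funM => //.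
  by apply: (@measurableT_comp _ _ _ _ _ _ (w \_ unitI) setT fst mw0); exact: measurable_fst.
by apply: (@measurableT_comp _ _ _ _ _ _ (h \_ unitI) setT snd mh0); exact: measurable_snd.
Qed.

Let h_integrable_cc x y : 0 < x -> y < 1 -> mu.-integrable `[x, y] (EFin \o h).
Proof.
move=> x0 y1; have [[_ _ hl] _] := Dgh.
have sub : `[x, y] `<=` unitI.
  move=> z; rewrite /unitI/= !in_itv/= => /andP[h1 h2].
  by rewrite (lt_le_trans x0)//= (le_lt_trans h2).
apply/integrableP; split.
  by apply/measurable_EFinP; apply: measurable_funS mh => //; exact: measurable_itv.
by apply: hl => //; exact: segment_compact.
Qed.

Let w_integrable x y : 0 <= x -> y <= 1 -> mu.-integrable `]x, y[ (EFin \o w).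
Proof.
move=> x0 y1; apply: integrableS iw => //.
move=> z; rewrite /unitI/= !in_itv/= => /andP[h1 h2].
by rewrite (le_lt_trans x0)//= (lt_le_trans h2).
Qed.

Let ker_right x t : 2^-1 <= x -> x < 1 ->
  ker (x, t) * (h \_ unitI) t = (h \_ `[2^-1, x[) t.
Proof.
move=> x2 x1; rewrite !patchE /unitI !mem_setE !in_itv/= /ker/=.
have h0 : 0 < 2^-1 :> R by rewrite invr_gt0.
case: (leP 2^-1 t) => t2 /=; case: (ltP t x) => tx /=; rewrite ?mul0r//.
- by rewrite mul1r (lt_le_trans h0 t2) (lt_trans tx x1).
- by have := lt_le_trans t2 (le_trans x2 tx); rewrite ltxx.
Qed.

Let ker_left x t : 0 < x -> x < 2^-1 ->
  ker (x, t) * (h \_ unitI) t = - (h \_ `[x, 2^-1[) t.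
Proof.
move=> x0 x2; rewrite !patchE /unitI !mem_setE !in_itv/= /ker/=.
have h1 : 2^-1 < 1 :> R by rewrite invf_lt1// ltr1n.
case: (leP 2^-1 t) => t2 /=.
  by rewrite andbF oppr0 ltNge (ltW (lt_le_trans x2 t2))/= mul0r.
case: (leP x t) => tx /=; rewrite ?mul0r ?oppr0//.
by rewrite mulN1r (lt_le_trans x0 tx) (lt_trans t2 h1).
Qed.

Let integral_scale_restrict (J : set R) (k : R) : measurable J ->
  mu.-integrable J (EFin \o h) ->
  (\int[mu]_t (k * (h \_ J) t)%:E = (k * \int[mu]_(t in J) h t)%:E)%E.
Proof.
move=> mJ iJ; rewrite EFinM /Rintegral fineK; last exact: integrable_fin_num.
rewrite -integralZl// [RHS]integral_mkcond; apply: eq_integral => t _.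
by rewrite !patchE; case: ifPn => //; rewrite mulr0.
Qed.

Let F_sectionx x : (\int[mu]_t F (x, t) =
  (((fun x => w x * (g x - g 2^-1)) \_ unitI) x)%:E)%E.
Proof.
rewrite patchE; case: ifPn => [xI|xI]; last first.
  rewrite -[RHS](integral0 mu setT); apply: eq_integral => t _.
  by rewrite /F/= patchE (negbTE xI) !mul0r.
have /andP[x0 x1] : 0 < x < 1 by move: xI; rewrite inE /unitI/= in_itv.
have half1 : 2^-1 < 1 :> R by rewrite invf_lt1// ltr1n.
have [x2|x2] := leP 2^-1 x.
  have [_ /(_ 2^-1 x _ x2 x1)] := Dgh; rewrite invr_gt0 ltr0n => /(_ isT) ->.
  have ih : mu.-integrable `[2^-1, x[ (EFin \o h).
    by apply: integrableS (h_integrable_cc 2^-1 x _ x1) => //; exact: subset_itv_co_cc.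
  rewrite -Rintegral_itv_bndo_bndc// -integral_scale_restrict//.
  by apply: eq_integral => t _; rewrite /F/= [in LHS]patchE xI -mulrA ker_right.
have [_ /(_ x 2^-1 x0 (ltW x2) half1)] := Dgh => e.
have ih : mu.-integrable `[x, 2^-1[ (EFin \o h).
  by apply: integrableS (h_integrable_cc x 2^-1 x0 _) => //; exact: subset_itv_co_cc.
rewrite -opprB e mulrN -mulNr.
rewrite -Rintegral_itv_bndo_bndc// -integral_scale_restrict//.
by apply: eq_integral => t _; rewrite /F/= [in LHS]patchE xI -mulrA ker_left// mulrN mulNr.
Qed.

Let w_ker_right x t : 2^-1 <= t -> t < 1 ->
  (w \_ unitI) x * ker (x, t) = (w \_ `]t, 1[) x.
Proof.
move=> t2 t1; rewrite !patchE /unitI !mem_setE !in_itv/= /ker/= t2.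
have h0 : 0 < 2^-1 :> R by rewrite invr_gt0.
case: (ltP t x) => tx /=; last by rewrite mulr0.
by rewrite mulr1 (lt_trans (lt_le_trans h0 t2) tx).
Qed.

Let w_ker_left x t : 0 < t -> t < 2^-1 ->
  (w \_ unitI) x * ker (x, t) = - (w \_ `]0, t]) x.
Proof.
move=> t0 t2; rewrite !patchE /unitI !mem_setE !in_itv/= /ker/= leNgt t2/=.
have h1 : 2^-1 < 1 :> R by rewrite invf_lt1// ltr1n.
case: (leP x t) => tx /=; last by rewrite andbF mulr0 oppr0.
rewrite (le_lt_trans tx (lt_trans t2 h1)) andbT.
by case: ifPn => _; rewrite ?mulrN1// mul0r oppr0.
Qed.

Let V_ge0 t : unitI t -> 0 <= V t.
Proof.
rewrite /unitI/= in_itv/= => /andP[t0 t1]; rewrite -lee_fin.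
by have [t2|/ltW t2] := leP 2^-1 t; [apply: le_trans (V_right _ t2 t1)|apply: le_trans (V_left _ t0 t2)];
  apply: integral_ge0 => x _; rewrite lee_fin.
Qed.

Let integral_restrict_abs (J : set R) k : measurable J -> 0 <= k ->
  measurable_fun J w ->
  (\int[mu]_x (`|(w \_ J) x| * k)%:E = k%:E * \int[mu]_(x in J) `|w x|%:E)%E.
Proof.
move=> mJ k0 mw; rewrite -ge0_integralZl//; last first.
  by apply/measurable_EFinP; exact: measurableT_comp.
rewrite [RHS]integral_mkcond; apply: eq_integral => t _.
by rewrite !patchE mulrC; case: ifPn => //; rewrite normr0 mulr0.
Qed.

Let F_abs_sectiony t : (\int[mu]_x `|F (x, t)| <=
  (((fun t => V t * `|h t|) \_ unitI) t)%:E)%E.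
Proof.
rewrite patchE; case: ifPn => [tI|tI]; last first.
  rewrite integral0_eq// => x _.
  by rewrite /F/= [X in _ * X]patchE (negbTE tI) !mulr0 normr0.
have t_I : unitI t by move: tI; rewrite inE.
have /andP[t0 t1] : 0 < t < 1 by move: tI; rewrite inE /unitI/= in_itv.
have [t2|t2] := leP 2^-1 t.
  under eq_integral => x _.
    rewrite /F/= w_ker_right// normrM [in X in _ * X]patchE tI.
    over.
  rewrite integral_restrict_abs//; last first.
    by apply: measurable_integrableR; apply: w_integrable => //; exact: ltW.
  by rewrite mulrC EFinM lee_wpmul2l// V_right.
under eq_integral => x _.
  rewrite /F/= w_ker_left// normrM normrN [in X in _ * X]patchE tI.
  over.
have mt : measurable_fun `]0, t] w.
  apply/measurable_fun_itv_bndo_bndcP.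
  by apply: measurable_integrableR; apply: w_integrable => //; exact: ltW.
rewrite integral_restrict_abs//.
rewrite mulrC EFinM lee_wpmul2l// -integral_itv_bndo_bndc ?V_left ?(ltW t2)//.
by apply/measurable_EFinP; apply: measurableT_comp => //; exact/measurable_fun_itv_bndo_bndcP.
Qed.

(** Tonelli with x integrated first: the inner integral of |F| is at most V |h|, integrable by
    [iVh]. *)
Let integrableF : (mu \x mu)%E.-integrable setT F.
Proof.
apply/(integrable21ltyP _ _ mF).
have iA : mu.-integrable setT (EFin \o ((fun t => V t * `|h t|) \_ unitI)).
  rewrite -restrict_EFin; apply/integrable_restrict => //.
  rewrite setTI; have := integrableR_norm _ iVh.
  apply: eq_integrable=> //.
  by move=> t /set_mem tI/=; rewrite normrM ger0_norm// V_ge0.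
apply: le_lt_trans (integrable_lty _ iA) => //.
apply: ge0_le_integral => //.
- by move=> t _; apply: integral_ge0.
- apply: (measurable_fun_fubini_tonelli_G (abse \o F)); last by move=> z; exact: abse_ge0.
  by apply: measurableT_comp.
- by case/integrableP : iA.
Qed.

(** Fubini's theorem makes the other iterated integrand, w (g - g(1/2)), integrable; adding g(1/2) w
    gives w g. This is how integrability passes from a derivative to the function. *)
Lemma weakD_integrable : L1 (fun x => w x * g x).
Proof.
have := integrable_fubini_F integrableF.
have -> : fubini_F mu F = EFin \o ((fun x => w x * (g x - g 2^-1)) \_ unitI).
  by apply/funext => x; exact: F_sectionx.
rewrite -restrict_EFin => /integrable_restrict => /(_ measurable_unitI measurableT).
rewrite setTI => i1.
have := integrableRD measurable_unitI i1 (integrableRZ measurable_unitI (g 2^-1) iw).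
apply: eq_integrable=> //.
by move=> x _ /=; congr _%:E; ring.
Qed.

(** Since w has mean zero, its integral over (t,1) is W t, and minus its integral over (0,t) is W t
    as well: the two branches of the kernel give the same section W h. The mean zero also removes
    the constant g(1/2). *)
Lemma weak_integration_by_parts (W : R -> R) :
  (forall t, 0 < t -> t < 1 -> \int[mu]_(x in `]0, t[) w x = - W t) ->
  \int[mu]_(x in unitI) w x = 0 ->
  \int[mu]_(x in unitI) (w x * g x) = \int[mu]_(t in unitI) (W t * h t).
Proof.
move=> wW w0.
have F_sectiony t : (\int[mu]_x F (x, t) =
    (((fun t => W t * h t) \_ unitI) t)%:E)%E.
  rewrite patchE; case: ifPn => [tI|tI]; last first.
    rewrite -[RHS](integral0 mu setT); apply: eq_integral => x _.
    by rewrite /F/= [in X in _ * X]patchE (negbTE tI) mulr0.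
  have /andP[t0 t1] : 0 < t < 1 by move: tI; rewrite inE /unitI/= in_itv.
  have scale (J : set R) k : measurable J -> mu.-integrable J (EFin \o w) ->
      (\int[mu]_x ((w \_ J) x * k)%:E = (\int[mu]_(x in J) w x * k)%:E)%E.
    move=> mJ iJ; rewrite EFinM /Rintegral fineK; last exact: integrable_fin_num.
    rewrite -integralZr// [RHS]integral_mkcond; apply: eq_integral => x _.
    by rewrite !patchE; case: ifPn => //; rewrite mul0r.
  have it : mu.-integrable `]0, t] (EFin \o w).
    apply: integrableS iw => //.
    by move=> x; rewrite /unitI/= !in_itv/= => /andP[-> /le_lt_trans]; exact.
  have wt : \int[mu]_(x in `]0, t]) w x = - W t.
    rewrite -Rintegral_itv_bndo_bndc ?wW//.
    by apply: integrableS it => //; exact: subset_itv_oo_oc.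
  have [t2|t2] := leP 2^-1 t.
    under eq_integral => x _.
      rewrite /F/= w_ker_right// [in X in _ * X]patchE tI.
      over.
    rewrite scale//; last by apply: w_integrable => //; exact: ltW.
    rewrite -(@Rintegral_itvB _ _ (BRight 0) (BLeft 1) t iw) ?bnd_simp ?(ltW t0)//.
    by rewrite wt -/unitI w0 sub0r opprK.
  under eq_integral => x _.
    rewrite /F/= w_ker_left// [in X in _ * X]patchE tI mulNr -mulrN.
    over.
  by rewrite scale// wt mulrNN.
have /(congr1 fine) := Fubini integrableF.
under eq_integral do rewrite F_sectionx.
under [in X in _ = X -> _]eq_integral do rewrite F_sectiony.
rewrite -[fine _]/(Rintegral mu setT _) -[RHS]/(Rintegral mu setT _) -2!Rintegral_mkcond => <-.
have i2 := integrableRZ measurable_unitI (g 2^-1) iw.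
have -> : \int[mu]_(x in unitI) (w x * (g x - g 2^-1)) =
          \int[mu]_(x in unitI) (w x * g x - g 2^-1 * w x).
  by apply: eq_Rintegral => x _; ring.
rewrite RintegralB//; last exact: weakD_integrable.
by rewrite RintegralZl// w0 mulr0 subr0.
Qed.

End weak_integration_by_parts.

(** * Integrals of rho G_n, and transfer of coefficients to the derivative *)

Section jacobi_integrals.
Context {R : realType}.
Local Notation mu := (@lebesgue_measure R).
Local Notation L1 f := (mu.-integrable unitI (EFin \o f)).
Implicit Types (a b c d x t : R) (n m : nat) (f g h : R -> R).

Lemma jacobiG_bounded n a b : exists2 M : R, 0 < M &
  forall x, unitI x -> `|jacobiG n a b x| <= M.
Proof.
exists (1 + \sum_(m < n.+1) `|jacobi_coef n a b m|).
  by rewrite ltr_pwDl// sumr_ge0.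
move=> x; rewrite /unitI/= in_itv/= => /andP[x0 x1].
rewrite jacobiGE (le_trans (ler_norm_sum _ _ _))// ler_wpDl//.
apply: ler_sum => m _; rewrite normrM ler_piMr// normrM !normrX.
by rewrite mulr_ile1 ?exprn_ge0// exprn_ile1// ger0_norm; lra.
Qed.

Lemma integrable_mul_jacobiG f n a b : L1 f -> L1 (fun x => f x * jacobiG n a b x).
Proof.
move=> i1; have [M M0 HM] := jacobiG_bounded n a b.
apply: (le_integrableR measurable_unitI (fun x => M * f x)).
- apply: measurable_funM; first exact: measurable_integrableR i1.
  by apply: measurable_funTS; apply: continuous_measurable_fun; exact: jacobiG_continuous.
- by move=> x xI; rewrite normrM (normrM M) (gtr0_norm M0) mulrC ler_wpM2r// HM.
- exact: integrableRZ.
Qed.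

Lemma rho_continuous a b x : 0 < x -> x < 1 -> {for x, continuous (rho a b : R -> R)}.
Proof.
by move=> x0 x1; apply: cvgM; [exact: onem_powR_continuous|exact: powR_continuous].
Qed.

Lemma rho_jacobiG_continuous n a b c d x : 0 < x -> x < 1 ->
  {for x, continuous (fun y => rho a b y * jacobiG n c d y)}.
Proof.
by move=> x0 x1; apply: cvgM; [exact: rho_continuous|exact: jacobiG_continuous].
Qed.

Lemma rho_jacobiG_cvg0 n a b c d : 0 < b ->
  rho a b y * jacobiG n c d y @[y --> (0 : R)^'+] --> (0 : R).
Proof.
move=> b0; rewrite -[X in _ --> X](mul0r (jacobiG n c d 0)); apply: cvgM.
  rewrite -[X in _ --> X](mulr0 ((1 - 0) `^ a)); apply: cvgM; last exact: powR_cvg0.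
  by apply: cvg_at_right_filter; apply: onem_powR_continuous.
by apply: cvg_at_right_filter; exact: jacobiG_continuous.
Qed.

Lemma rho_jacobiG_cvg1 n a b c d : 0 < a ->
  rho a b y * jacobiG n c d y @[y --> (1 : R)^'-] --> (0 : R).
Proof.
move=> a0; rewrite -[X in _ --> X](mul0r (jacobiG n c d 1)); apply: cvgM.
  rewrite -[X in _ --> X](mul0r (1 `^ b)); apply: cvgM; first exact: onem_powR_cvg_left.
  by apply: cvg_at_left_filter; apply: powR_continuous.
by apply: cvg_at_left_filter; exact: jacobiG_continuous.
Qed.

Section parameters.
Context {a b : R} (a1 : -1 < a) (b1 : -1 < b).

Let a10 : 0 < a + 1. Proof. by rewrite -ltrBlDr sub0r. Qed.

Let b10 : 0 < b + 1. Proof. by rewrite -ltrBlDr sub0r. Qed.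

Lemma integrable_rho_jacobiG n c d : L1 (fun x => rho a b x * jacobiG n c d x).
Proof. by apply: integrable_mul_jacobiG; exact: integrable_rho. Qed.

(** One-sided limits let a single statement cover (0,t) and (0,1): the raised weight tends to 0 at
    both ends, and at an interior t the primitive is continuous. *)
Let Rodrigues n A B u v : 0 <= u -> u < v -> v <= 1 ->
  (fun y => rho (a + 1) (b + 1) y * jacobiG n (a + 1) (b + 1) y) @ u^'+ --> A ->
  (fun y => rho (a + 1) (b + 1) y * jacobiG n (a + 1) (b + 1) y) @ v^'- --> B ->
  \int[mu]_(x in `]u, v[) (rho a b x * jacobiG n.+1 a b x) = - (n.+1%:R^-1 * (B - A)).
Proof.
move=> u0 uv v1 cA cB.
have uv01 x : x \in `]u, v[ -> 0 < x /\ x < 1.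
  by rewrite in_itv/= => /andP[ux xv]; rewrite (le_lt_trans u0 ux) (lt_le_trans xv v1).
rewrite (FTC_open _ (fun y => - n.+1%:R^-1 * (rho (a + 1) (b + 1) y * jacobiG n (a + 1) (b + 1) y))
  _ _ (- n.+1%:R^-1 * A) (- n.+1%:R^-1 * B) uv).
- by ring.
- move=> x /uv01[x0 x1].
  have h := @is_deriveZ R _ _ _ (- n.+1%:R^-1) _ _ _ (is_derive_rho_jacobiG n a b x x0 x1).
  apply: (@is_derive_eq _ _ _ _ _ _ _ _ h); rewrite /GRing.scale/= mulrNN mulKf//.
- by move=> x /uv01[x0 x1]; exact: rho_jacobiG_continuous.
- apply: integrableS (integrable_rho_jacobiG n.+1 a b) => //.
  by move=> x /= /uv01[x0 x1]; rewrite /unitI/= in_itv/= x0.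
- exact: cvgMr.
- exact: cvgMr.
Qed.

Lemma integral_rho_jacobiG n t : 0 < t -> t < 1 ->
  \int[mu]_(x in `]0, t[) (rho a b x * jacobiG n.+1 a b x) =
  - (n.+1%:R^-1 * (rho (a + 1) (b + 1) t * jacobiG n (a + 1) (b + 1) t)).
Proof.
move=> t0 t1; rewrite (@Rodrigues n 0 (rho (a + 1) (b + 1) t * jacobiG n (a + 1) (b + 1) t)) ?subr0 ?(ltW t1)//.
  exact: rho_jacobiG_cvg0.
by apply: cvg_at_left_filter; exact: rho_jacobiG_continuous.
Qed.

Lemma integral_rho_jacobiG0 n : \int[mu]_(x in unitI) (rho a b x * jacobiG n.+1 a b x) = 0.
Proof.
rewrite (@Rodrigues n 0 0) ?subr0 ?mulr0 ?oppr0//.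
  exact: rho_jacobiG_cvg0.
exact: rho_jacobiG_cvg1.
Qed.

(** Integration by parts with w = rho G_m, whose tails are at most sup |G_m| times those of rho, and
    with W from Rodrigues' formula. Integrability holds for every degree including 0; the identity
    starts at degree 1, where the mean of w vanishes. *)
Lemma weakD_rho_jacobiG g h n : is_D g h -> L1 (fun x => rho (a + 1) (b + 1) x * h x) ->
  L1 (fun x => rho a b x * jacobiG n a b x * g x) /\
  \int[mu]_(x in unitI) (rho a b x * jacobiG n.+1 a b x * g x) =
  n.+1%:R^-1 * \int[mu]_(x in unitI) (rho (a + 1) (b + 1) x * jacobiG n (a + 1) (b + 1) x * h x).
Proof.
move=> Dgh ih.
have [C C0 HC] := rho_tail_bounds a b a1 b1.
(* The bound is chosen as a function of m, since degrees n and n+1 both occur; [jacobiG_bounded]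
   shows that the default 1 is never reached for want of a bound. *)
pose M m := xget 1 [set M | 0 < M /\ forall x, unitI x -> `|jacobiG m a b x| <= M].
have HM m : 0 < M m /\ forall x, unitI x -> `|jacobiG m a b x| <= M m.
  have [M0 M00 M0b] := jacobiG_bounded m a b.
  exact: (@xgetPex _ 1 [set M | 0 < M /\ forall x, unitI x -> `|jacobiG m a b x| <= M]
    (ex_intro _ M0 (conj M00 M0b))).
pose V m x := M m * C * rho (a + 1) (b + 1) x.
have iVh m : L1 (fun x => V m x * h x).
  have := integrableRZ measurable_unitI (M m * C) ih.
  by apply: eq_integrable => // x _; rewrite /= /V mulrA.
have bound m (J : set R) K : measurable J -> J `<=` unitI ->
    (\int[mu]_(x in J) (rho a b x)%:E <= (C * K)%:E)%E ->
    (\int[mu]_(x in J) `|rho a b x * jacobiG m a b x|%:E <= (M m * C * K)%:E)%E.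
  move=> mJ JI HK; have [M0 Mb] := HM m.
  apply: (@le_trans _ _ (\int[mu]_(x in J) ((M m)%:E * (rho a b x)%:E))%E).
    apply: ge0_le_integral => //.
    - apply/measurable_EFinP; apply: measurableT_comp => //; apply: measurable_funM.
        exact: measurable_rho.
      by apply: measurable_funTS; apply: continuous_measurable_fun; exact: jacobiG_continuous.
    - apply/measurable_EFinP; apply: measurable_funM => //; exact: measurable_rho.
    - move=> x Jx; rewrite -EFinM lee_fin normrM ger0_norm ?rho_ge0// mulrC.
      by rewrite ler_wpM2r ?rho_ge0// Mb//; exact: JI.
  rewrite ge0_integralZl//; last 3 first.
  - by apply/measurable_EFinP; exact: measurable_rho.
  - by move=> x _; rewrite lee_fin rho_ge0.
  - by rewrite lee_fin ltW.
  by rewrite -mulrA EFinM lee_wpmul2l// lee_fin ltW.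
have Vr m t : 2^-1 <= t -> t < 1 ->
    (\int[mu]_(x in `]t, 1%R[) `|rho a b x * jacobiG m a b x|%:E <= (V m t)%:E)%E.
  move=> t2 t1; apply: bound => //.
    move=> x; rewrite /unitI/= !in_itv/= => /andP[tx ->].
    by rewrite andbT (lt_trans _ tx)// (lt_le_trans _ t2)// invr_gt0.
  by have [+ _] := HC t; apply.
have Vl m t : 0 < t -> t <= 2^-1 ->
    (\int[mu]_(x in `]0%R, t[) `|rho a b x * jacobiG m a b x|%:E <= (V m t)%:E)%E.
  move=> t0 t2; apply: bound => //.
    move=> x; rewrite /unitI/= !in_itv/= => /andP[-> xt]/=.
    by rewrite (lt_le_trans xt)// (le_trans t2)// invf_le1// ler1n.
  by have [_] := HC t; apply.
split.
  exact: (weakD_integrable _ _ _ _ Dgh (integrable_rho_jacobiG n a b) (iVh n) (Vr n) (Vl n)).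
rewrite (weak_integration_by_parts _ _ _ _ Dgh (integrable_rho_jacobiG n.+1 a b) (iVh n.+1) (Vr n.+1) (Vl n.+1)
  (fun t => n.+1%:R^-1 * (rho (a + 1) (b + 1) t * jacobiG n (a + 1) (b + 1) t))).
- rewrite -RintegralZl//.
    by apply: eq_Rintegral => x _; rewrite mulrA.
  have := integrable_mul_jacobiG _ n (a + 1) (b + 1) ih.
  by apply: eq_integrable => // x _ /=; congr _%:E; ring.
- exact: integral_rho_jacobiG.
- exact: integral_rho_jacobiG0.
Qed.

Lemma weakD_rho g h : is_D g h -> L1 (fun x => rho (a + 1) (b + 1) x * h x) ->
  L1 (fun x => rho a b x * g x).
Proof.
move=> Dgh ih; have [+ _] := weakD_rho_jacobiG g h 0 Dgh ih.
by apply: eq_integrable => // x _ /=; rewrite jacobiG0 mulr1.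
Qed.

End parameters.
End jacobi_integrals.

(** * Orthogonality and ratios of norms *)

Section jacobi_orthogonality.
Context {R : realType}.
Local Notation mu := (@lebesgue_measure R).
Local Notation L1 f := (mu.-integrable unitI (EFin \o f)).
Implicit Types (a b c d x t : R) (n m : nat) (f g h : R -> R).

Lemma integrable_jacobiG n a b : L1 (jacobiG n a b).
Proof.
have := @integrable_rho_jacobiG R 0 0 (ltrN10 _) (ltrN10 _) n a b.
by apply: eq_integrable => // x _ /=; rewrite /rho !powRr0 !mul1r.
Qed.

Lemma is_D_jacobiG n a b : is_D (jacobiG n.+1 a b)
  (fun x => (n.+1%:R + a + b + 1) * jacobiG n (a + 1) (b + 1) x).
Proof.
split.
  apply: open_integrable_locally; first exact: interval_open.
  by apply: (integrableRZ measurable_unitI); exact: integrable_jacobiG.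
move=> x y x0; rewrite le_eqVlt => /predU1P[<- _|xy y1].
  by rewrite set_itv1 Rintegral_set1 subrr.
rewrite /Rintegral (FTC_sub_itv _ (jacobiG n.+1 a b) 0 1)//.
- by move=> z _; exact: is_derive_jacobiG.
- by move=> z _; apply: cvgMr; exact: jacobiG_continuous.
Qed.

(** Each integration by parts lowers both degrees and raises both parameters by one, until the lower
    degree is 0 and the statement is that rho G_n has mean zero. *)
Lemma jacobiG_orthogonal n m a b : -1 < a -> -1 < b -> (m < n)%N ->
  \int[mu]_(x in unitI) (rho a b x * jacobiG n a b x * jacobiG m a b x) = 0.
Proof.
elim: n m a b => // n IH [|m] a b a1 b1 mn.
  rewrite -(integral_rho_jacobiG0 a1 b1 n).
  by apply: eq_Rintegral => x _; rewrite jacobiG0 mulr1.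
have a2 : -1 < a + 1 by lra.
have b2 : -1 < b + 1 by lra.
have Dg := is_D_jacobiG m a b.
have i1 : L1 (fun x => rho (a + 1) (b + 1) x * ((m.+1%:R + a + b + 1) * jacobiG m (a + 1) (b + 1) x)).
  have := integrableRZ measurable_unitI (m.+1%:R + a + b + 1) (integrable_rho_jacobiG a2 b2 m (a + 1) (b + 1)).
  by apply: eq_integrable => // x _ /=; congr _%:E; ring.
have [_ ->] := weakD_rho_jacobiG a1 b1 _ _ n Dg i1.
have e : \int[mu]_(x in unitI) (rho (a + 1) (b + 1) x * jacobiG n (a + 1) (b + 1) x *
    ((m.+1%:R + a + b + 1) * jacobiG m (a + 1) (b + 1) x)) =
  \int[mu]_(x in unitI) ((m.+1%:R + a + b + 1) *
    (rho (a + 1) (b + 1) x * jacobiG n (a + 1) (b + 1) x * jacobiG m (a + 1) (b + 1) x)).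
  by apply: eq_Rintegral => x _; ring.
rewrite e RintegralZl//; first by rewrite IH// !mulr0.
by apply: integrable_mul_jacobiG; exact: integrable_rho_jacobiG.
Qed.

Lemma Gnorm_sqr n a b :
  Gnorm n a b ^+ 2 = \int[mu]_(x in unitI) (rho a b x * jacobiG n a b x ^+ 2).
Proof.
rewrite /Gnorm sqr_sqrtr// Rintegral_ge0// => x _.
by rewrite mulr_ge0 ?rho_ge0// sqr_ge0.
Qed.

(** G_(n+1) is integrated by parts against itself: Rodrigues' primitive contributes 1/(n+1), the
    derivative of G_(n+1) the factor n+a+b+2. *)
Lemma Gnorm_succ n a b : -1 < a -> -1 < b ->
  n.+1%:R * Gnorm n.+1 a b ^+ 2 =
  (n.+1%:R + a + b + 1) * Gnorm n (a + 1) (b + 1) ^+ 2.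
Proof.
move=> a1 b1; have a2 : -1 < a + 1 by lra.
have b2 : -1 < b + 1 by lra.
have Dg := is_D_jacobiG n a b.
have i1 : L1 (fun x => rho (a + 1) (b + 1) x * ((n.+1%:R + a + b + 1) * jacobiG n (a + 1) (b + 1) x)).
  have := integrableRZ measurable_unitI (n.+1%:R + a + b + 1) (integrable_rho_jacobiG a2 b2 n (a + 1) (b + 1)).
  by apply: eq_integrable => // x _ /=; congr _%:E; ring.
have [_ e] := weakD_rho_jacobiG a1 b1 _ _ n Dg i1.
rewrite !Gnorm_sqr.
have -> : \int[mu]_(x in unitI) (rho a b x * jacobiG n.+1 a b x ^+ 2) =
   \int[mu]_(x in unitI) (rho a b x * jacobiG n.+1 a b x * jacobiG n.+1 a b x).
  by apply: eq_Rintegral => x _; ring.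
rewrite e mulrA mulfV ?mul1r// -RintegralZl//.
  by apply: eq_Rintegral => x _; ring.
have := integrable_mul_jacobiG _ n (a + 1) (b + 1) (integrable_rho_jacobiG a2 b2 n (a + 1) (b + 1)).
by apply: eq_integrable => // x _ /=; congr _%:E; ring.
Qed.

(** Positive exponents make rho continuous on [0,1], as the substitution x -> 1 - x on the closed
    interval demands. *)
Lemma integral_rho_sym a b : 0 < a -> 0 < b ->
  \int[mu]_(x in unitI) rho a b x = \int[mu]_(x in unitI) rho b a x.
Proof.
have cc c d : 0 < c -> 0 < d ->
    \int[mu]_(x in unitI) rho c d x = \int[mu]_(x in `[0, 1]) rho c d x.
  move=> c0 d0; have i1 : L1 (rho c d) by apply: integrable_rho; lra.
  rewrite -Rintegral_itv_obnd_cbnd; first exact: Rintegral_itv_bndo_bndc.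
  by apply: integrableS (integrable_itv_oo_cc _ _ _ i1) => //; exact: subset_itv_oc_cc.
move=> a0 b0; rewrite !cc// Rintegration_by_substitution_onem ?lexx ?ler01//.
  rewrite {1}/unstable.onem subrr; apply: eq_Rintegral => x _.
  by rewrite /rho /unstable.onem subKr mulrC.
apply/continuous_within_itvP => //; split.
- by move=> x; rewrite in_itv/= => /andP[x0 x1]; exact: rho_continuous.
- have := rho_jacobiG_cvg0 0 a b 0 0 b0; rewrite /rho powR0 ?gt_eqF// mulr0.
  by apply: cvg_trans; apply: near_eq_cvg; near=> x; rewrite jacobiG0 mulr1.
- have := rho_jacobiG_cvg1 0 a b 0 0 a0; rewrite /rho subrr powR0 ?gt_eqF// mul0r.
  by apply: cvg_trans; apply: near_eq_cvg; near=> x; rewrite jacobiG0 mulr1.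
Unshelve. all: by end_near. Qed.

(** The ratio in [Gnorm_succ] is symmetric in a and b, so induction reduces the claim to degree 0,
    that is, to the integrals of the weights. *)
Lemma Gnorm_sym n a b : 0 < a -> 0 < b -> Gnorm n a b ^+ 2 = Gnorm n b a ^+ 2.
Proof.
elim: n a b => [|n IH] a b a0 b0.
  rewrite !Gnorm_sqr; transitivity (\int[mu]_(x in unitI) rho a b x).
    by apply: eq_Rintegral => x _; rewrite jacobiG0 expr1n mulr1.
  rewrite integral_rho_sym//.
  by apply: eq_Rintegral => x _; rewrite jacobiG0 expr1n mulr1.
have n0 : n.+1%:R != 0 :> R by rewrite pnatr_eq0.
have a1 : -1 < a by lra.
have b1 : -1 < b by lra.
apply: (mulfI n0).
rewrite (@Gnorm_succ n a b)// (@Gnorm_succ n b a)// (IH (a + 1) (b + 1)) ?addr_gt0//.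
by congr (_ * _); ring.
Qed.

End jacobi_orthogonality.

(** * Bessel's inequality, and energies of iterated derivatives *)

Section bessel.
Context {R : realType}.
Local Notation mu := (@lebesgue_measure R).
Local Notation L1 f := (mu.-integrable unitI (EFin \o f)).
Implicit Types (a b c d x t : R) (n m M : nat) (f g h : R -> R).

Lemma integrable_lincomb (phi : R -> R) (e : nat -> R -> R) (d : nat -> R) M :
  (forall k, (k < M)%N -> L1 (fun x => phi x * e k x)) ->
  L1 (fun x => phi x * \sum_(k < M) d k * e k x).
Proof.
move=> H.
have := @integrableR_sum R unitI measurable_unitI M (fun k x => d k * (phi x * e k x)).
move=> /(_ (fun k kM => integrableRZ measurable_unitI (d k) (H k kM))).
apply: eq_integrable => // x _ /=; congr _%:E; rewrite big_distrr/=.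
by apply: eq_bigr => k _; ring.
Qed.

Lemma Rintegral_lincomb (phi : R -> R) (e : nat -> R -> R) (d : nat -> R) M :
  (forall k, (k < M)%N -> L1 (fun x => phi x * e k x)) ->
  \int[mu]_(x in unitI) (phi x * \sum_(k < M) d k * e k x) =
  \sum_(k < M) d k * \int[mu]_(x in unitI) (phi x * e k x).
Proof.
move=> H.
transitivity (\int[mu]_(x in unitI) (\sum_(k < M) d k * (phi x * e k x))).
  by apply: eq_Rintegral => x _; rewrite big_distrr/=; apply: eq_bigr => k _; ring.
rewrite (@Rintegral_sum R unitI measurable_unitI M (fun k x => d k * (phi x * e k x))).
  by apply: eq_bigr => k _; rewrite RintegralZl//; exact: H.
by move=> k kM; apply: (integrableRZ measurable_unitI); exact: H.
Qed.

Section expansion.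
Context {a b : R} (a1 : -1 < a) (b1 : -1 < b).

Lemma jacobiG_orthonorm n m :
  \int[mu]_(x in unitI) (rho a b x * jacobiG n a b x * jacobiG m a b x) =
  if n == m then Gnorm n a b ^+ 2 else 0.
Proof.
have [<-|nm] := eqVneq n m.
  by rewrite Gnorm_sqr; apply: eq_Rintegral => x _; ring.
have [lt|lt] : (m < n)%N \/ (n < m)%N by apply/orP; rewrite -neq_ltn eq_sym.
  exact: jacobiG_orthogonal.
rewrite -(jacobiG_orthogonal _ _ a b a1 b1 lt).
by apply: eq_Rintegral => x _; ring.
Qed.

(** The offset p lets the sum start at any degree, as tails of expansions require. *)
Lemma integral_sqr_lincomb (d : nat -> R) (p M : nat) :
  \int[mu]_(x in unitI) (rho a b x * (\sum_(k < M) d k * jacobiG (p + k) a b x) ^+ 2) =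
  \sum_(k < M) d k ^+ 2 * Gnorm (p + k) a b ^+ 2.
Proof.
pose S x := \sum_(k < M) d k * jacobiG (p + k) a b x.
have iS : L1 (fun x => rho a b x * S x).
  by apply: (integrable_lincomb (rho a b) (fun k => jacobiG (p + k) a b)) => k _;
     exact: integrable_rho_jacobiG.
transitivity (\int[mu]_(x in unitI) (rho a b x * S x * S x)).
  by apply: eq_Rintegral => x _; rewrite -/(S x); ring.
rewrite (Rintegral_lincomb (fun x => rho a b x * S x) (fun k => jacobiG (p + k) a b)); last first.
  by move=> k _; exact: integrable_mul_jacobiG.
apply: eq_bigr => k _; rewrite expr2 -mulrA; congr (_ * _).
transitivity (\int[mu]_(x in unitI) (rho a b x * jacobiG (p + k) a b x * S x)).
  by apply: eq_Rintegral => x _; ring.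
rewrite (Rintegral_lincomb (fun x => rho a b x * jacobiG (p + k) a b x) (fun k => jacobiG (p + k) a b)); last first.
  by move=> l _; apply: integrable_mul_jacobiG; exact: integrable_rho_jacobiG.
rewrite (bigD1 k)//= jacobiG_orthonorm eqxx big1 ?addr0// => l lk.
by rewrite jacobiG_orthonorm eqn_add2l ifN ?mulr0// eq_sym.
Qed.

(** The squared weighted norm of the component of F along G_n. *)
Definition jacobi_energy n c d (F : R -> R) : R :=
  (\int[mu]_(x in unitI) (rho c d x * jacobiG n c d x * F x)) ^+ 2 / Gnorm n c d ^+ 2.

Lemma integrable_rho_of_sqr (F : R -> R) : measurable_fun unitI F ->
  L1 (fun x => rho a b x * F x ^+ 2) -> L1 (fun x => rho a b x * F x).
Proof.
move=> mF i2.
apply: (le_integrableR measurable_unitI (fun x => rho a b x + rho a b x * F x ^+ 2)).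
- by apply: measurable_funM => //; exact: measurable_rho.
- move=> x _; have r0 := rho_ge0 a b x.
  have p0 : 0 <= rho a b x + rho a b x * F x ^+ 2 by rewrite addr_ge0// mulr_ge0// sqr_ge0.
  rewrite normrM (ger0_norm r0) (ger0_norm p0).
  rewrite -[X in _ <= X + _]mulr1 -mulrDr ler_wpM2l//.
  rewrite -(real_normK (num_real (F x))).
  have := sqr_ge0 (`|F x| - 2^-1); nra.
- by apply: (integrableRD measurable_unitI) => //; exact: integrable_rho.
Qed.

(** The weighted integral of (F - S)^2 is nonnegative for the partial projection S; both the product
    F S and S^2 integrate to the sum of the energies. *)
Lemma bessel_jacobi (F : R -> R) p M : measurable_fun unitI F ->
  L1 (fun x => rho a b x * F x ^+ 2) ->
  \sum_(k < M) jacobi_energy (p + k) a b F <=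
  \int[mu]_(x in unitI) (rho a b x * F x ^+ 2).
Proof.
move=> mF i2; have i1 := integrable_rho_of_sqr F mF i2.
pose d k := (\int[mu]_(x in unitI) (rho a b x * jacobiG (p + k) a b x * F x)) / Gnorm (p + k) a b ^+ 2.
pose S x := \sum_(k < M) d k * jacobiG (p + k) a b x.
have iFe k : (k < M)%N -> L1 (fun x => rho a b x * F x * jacobiG (p + k) a b x).
  by move=> _; exact: integrable_mul_jacobiG.
have iFS : L1 (fun x => rho a b x * F x * S x).
  exact: (integrable_lincomb (fun x => rho a b x * F x) (fun k => jacobiG (p + k) a b)).
have iS : L1 (fun x => rho a b x * S x).
  by apply: (integrable_lincomb (rho a b) (fun k => jacobiG (p + k) a b)) => k _;
     exact: integrable_rho_jacobiG.
have iSS : L1 (fun x => rho a b x * S x * S x).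
  apply: (integrable_lincomb (fun x => rho a b x * S x) (fun k => jacobiG (p + k) a b)) => k _.
  exact: integrable_mul_jacobiG.
have e1 : \int[mu]_(x in unitI) (rho a b x * F x * S x) = \sum_(k < M) jacobi_energy (p + k) a b F.
  rewrite (Rintegral_lincomb _ (fun k => jacobiG (p + k) a b))//.
  apply: eq_bigr => k _; rewrite /d /jacobi_energy mulrAC; congr (_ / _).
  by rewrite expr2; congr (_ * _); apply: eq_Rintegral => x _; ring.
have e2 : \int[mu]_(x in unitI) (rho a b x * S x * S x) = \sum_(k < M) jacobi_energy (p + k) a b F.
  transitivity (\int[mu]_(x in unitI) (rho a b x * S x ^+ 2)).
    by apply: eq_Rintegral => x _; ring.
  rewrite integral_sqr_lincomb; apply: eq_bigr => k _; rewrite /d /jacobi_energy.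
  (* For a zero norm both sides vanish, the inverse of 0 being 0. *)
  have [->|n0] := eqVneq (Gnorm (p + k) a b) 0; first by rewrite expr0n/= invr0 !mulr0.
  by field.
have : 0 <= \int[mu]_(x in unitI) (rho a b x * (F x - S x) ^+ 2).
  by apply: Rintegral_ge0 => x _; rewrite mulr_ge0 ?rho_ge0// sqr_ge0.
have -> : \int[mu]_(x in unitI) (rho a b x * (F x - S x) ^+ 2) =
    \int[mu]_(x in unitI) ((rho a b x * F x ^+ 2 - 2 * (rho a b x * F x * S x)) + rho a b x * S x * S x).
  by apply: eq_Rintegral => x _; ring.
have i3 := integrableRZ measurable_unitI 2 iFS.
have i4 := integrableRB measurable_unitI i2 i3.
rewrite RintegralD// RintegralB// RintegralZl// e1 e2; lra.
Qed.

End expansion.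

(** The squared coefficient contributes (n+1)^-2 and the ratio of squared norms (n+1)/(n+a+b+2). *)
Lemma jacobi_energy_succ a b n g h : -1 < a -> -1 < b -> is_D g h ->
  L1 (fun x => rho (a + 1) (b + 1) x * h x) ->
  jacobi_energy n.+1 a b g * (n.+1%:R * (n.+1%:R + a + b + 1)) =
  jacobi_energy n (a + 1) (b + 1) h.
Proof.
move=> a1 b1 Dgh ih; rewrite /jacobi_energy.
have [_ ->] := weakD_rho_jacobiG a1 b1 _ _ n Dgh ih.
have e := Gnorm_succ n a b a1 b1.
have n0 : n.+1%:R != 0 :> R by rewrite pnatr_eq0.
have s0 : n.+1%:R + a + b + 1 != 0.
  by have n1 : 1 <= n.+1%:R :> R; rewrite ?ler1n// gt_eqF//; lra.
set I := Rintegral _ _ _.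
have [G0|G0] := eqVneq (Gnorm n (a + 1) (b + 1) ^+ 2) 0.
  move: e; rewrite G0 mulr0 => /eqP; rewrite mulf_eq0 (negbTE n0)/= => /eqP ->.
  by rewrite invr0 !mulr0 mul0r.
have -> : Gnorm n.+1 a b ^+ 2 = (n.+1%:R + a + b + 1) * Gnorm n (a + 1) (b + 1) ^+ 2 / n.+1%:R.
  by rewrite -e mulrC mulKf.
move: (Gnorm n (a + 1) (b + 1) ^+ 2) G0 => G G0; move: (n.+1%:R + a + b + 1) s0 => s s0.
move: (n.+1%:R : R) n0 => m n0.
by field; rewrite G0 s0 n0.
Qed.

(** After i derivatives the degree is n-i and each parameter has grown by i, so the next factor is
    (n-i)(n+i+a+b+1). Only the top derivative is assumed integrable; integrability is part of the
    conclusion because the induction hands it down one derivative at a time. *)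
Lemma jacobi_energy_iter j (F : nat -> R -> R) a b n : -1 < a -> -1 < b ->
  (forall i, (i < j)%N -> is_D (F i) (F i.+1)) ->
  L1 (fun x => rho (a + j%:R) (b + j%:R) x * F j x) -> (j <= n)%N ->
  L1 (fun x => rho a b x * F 0%N x) /\
  jacobi_energy n a b (F 0%N) *
    \prod_(i < j) ((n%:R - i%:R) * (n%:R + i%:R + a + b + 1)) =
  jacobi_energy (n - j) (a + j%:R) (b + j%:R) (F j).
Proof.
elim: j F a b n => [|j IH] F a b n a1 b1 DF iF jn.
  by move: iF; rewrite !addr0 => iF; split=> //; rewrite big_ord0 mulr1 subn0.
case: n jn => // n; rewrite ltnS => jn.
have a2 : -1 < a + 1 by lra.
have b2 : -1 < b + 1 by lra.
have ea : a + j.+1%:R = a + 1 + j%:R by rewrite -natr1; ring.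
have eb : b + j.+1%:R = b + 1 + j%:R by rewrite -natr1; ring.
rewrite ea eb in iF *.
have [i1 e1] := IH (fun i => F i.+1) (a + 1) (b + 1) n a2 b2 (fun i ij => DF i.+1 ij) iF jn.
split; first exact: (weakD_rho a1 b1 _ _ (DF 0%N isT) i1).
rewrite subSS -e1 -(jacobi_energy_succ _ _ n _ _ a1 b1 (DF 0%N isT) i1).
rewrite -mulrA; congr (_ * _); rewrite big_ord_recl/= subr0 addr0; congr (_ * _).
by apply: eq_bigr => i _; rewrite /bump/= add1n -!natr1; ring.
Qed.

(** Near i = j the factor n-i can be far below n, but i < j <= n yields n <= j (n-i). Factor by
    factor this costs j^j, a constant free of n and s. *)
Lemma prod_energy_lower j N n (s : R) : (N <= n)%N -> (j <= n)%N -> 0 <= s ->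
  (N%:R * (N%:R + s)) ^+ j <=
  j%:R ^+ j * \prod_(i < j) ((n%:R - i%:R) * (n%:R + i%:R + s)).
Proof.
move=> Nn jn s0.
have -> : (N%:R * (N%:R + s)) ^+ j = \prod_(i < j) (N%:R * (N%:R + s)).
  by rewrite prodr_const card_ord.
have -> : (j%:R : R) ^+ j = \prod_(i < j) j%:R by rewrite prodr_const card_ord.
rewrite -big_split/=; apply: ler_prod => i _.
have ij := ltn_ord i.
have N0 : 0 <= N%:R :> R by rewrite ler0n.
rewrite mulr_ge0 ?addr_ge0//= mulrA.
have h1 : (n <= j * (n - i))%N.
  have := leq_mul (leqnn j) (leq_sub2l n (ltnW ij)).
  have : (n - i = (n - j) + (j - i))%N by rewrite addnBA ?subnK// ltnW.
  move=> -> _; rewrite mulnDr -{1}(subnK jn) leq_add//.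
    by rewrite leq_pmull// (leq_trans _ ij).
  by rewrite leq_pmulr// subn_gt0.
have h2 : n%:R <= j%:R * (n%:R - i%:R) :> R.
  by rewrite -natrB ?(leq_trans (ltnW ij))// -natrM ler_nat.
have h3 : N%:R <= n%:R :> R by rewrite ler_nat.
apply: ler_pM => //; first by rewrite addr_ge0.
  exact: le_trans h2.
by rewrite lerD2r (le_trans h3)// lerDl.
Qed.

End bessel.

(** * A lower bound for Gamma(i+alpha)/i! *)

Section gamma_bound.
Context {R : realType}.
Local Notation mu := (@lebesgue_measure R).
Local Notation pos := (`]0, +oo[%classic : set (measurableTypeR R)).
Implicit Types (n i : nat) (s t y : R).

(** The exponential exceeds t^(n+1)/(n+1)!, whence the majorant (n+1)!/t. *)
Lemma exprn_expRN_cvg0 n : t ^+ n * expR (- t) @[t --> +oo] --> (0 : R).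
Proof.
apply: (@squeeze_cvgr _ _ _ _ (cst 0) (fun t => n.+1`!%:R * t^-1)).
- near=> t; have t0 : 0 < t by [].
  have f0 : 0 < n.+1`!%:R :> R by rewrite ltr0n fact_gt0.
  rewrite mulr_ge0 ?exprn_ge0 ?expR_ge0 ?(ltW t0)//=.
  rewrite expRN ler_pdivrMr ?expR_gt0// mulrAC ler_pdivlMr// -exprSr.
  have := expR_ge1Dxn n (ltW t0) => h.
  have : t ^+ n.+1 / n.+1`!%:R <= expR t by apply: le_trans h; rewrite lerDr.
  by rewrite ler_pdivrMr// mulrC.
- exact: cvg_cst.
- by rewrite -[X in _ --> X](mulr0 n.+1`!%:R); apply: cvgMr;
    apply/(gtr0_cvgV0 (f := id)); [near=> t|exact: cvg_id].
Unshelve. all: by end_near. Qed.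

Lemma primitive_exprn_expRN n : exists F : R -> R,
  [/\ forall t, is_derive t (1 : R) F (t ^+ n * expR (- t)),
      F 0 = - n`!%:R & F t @[t --> +oo] --> (0 : R)].
Proof.
have dE t : is_derive t (1 : R) (fun t : R => expR (- t)) (- expR (- t)).
  have h1 : is_derive t (1 : R) (fun t : R => - t) (-1) by apply: is_derive_eq.
  have := @is_derive1_comp R expR (fun t : R => - t) t _ _ (is_derive_expR (- t)) h1.
  by rewrite mulrN1.
elim: n => [|n [F [dF F0 Foo]]].
  exists (fun t => - expR (- t)); split.
  - move=> t; have h := is_deriveN (dE t).
    by apply: (@is_derive_eq _ _ _ _ _ _ _ _ h); rewrite opprK mul1r.
  - by rewrite oppr0 expR0.
  - rewrite -[X in _ --> X]oppr0; apply: cvgN; exact: cvgr_expR.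
(* One integration by parts; the value at 0 then follows the recursion of the factorial. *)
exists (fun t => n.+1%:R * F t - t ^+ n.+1 * expR (- t)); split.
- move=> t; have h1 := @is_deriveZ R _ _ _ n.+1%:R _ _ _ (dF t).
  have h2 := @is_deriveM R _ (fun y : R => y ^+ n.+1) (fun t : R => expR (- t)) t 1 _ _ (is_derive_exprn n.+1 t) (dE t).
  have h := is_deriveB h1 h2.
  by apply: (@is_derive_eq _ _ _ _ _ _ _ _ h); rewrite /GRing.scale/=; ring.
- by rewrite F0 expr0n/= mul0r subr0 factS natrM mulrN.
- rewrite -[X in _ --> X](subrr (0 : R)); apply: cvgB; last exact: exprn_expRN_cvg0.
  by rewrite -[X in _ --> X](mulr0 n.+1%:R); apply: cvgMr.
Qed.

Lemma integral_exprn_expRN n :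
  (\int[mu]_(t in `]0%R, +oo[) (t ^+ n * expR (- t))%:E = n`!%:R%:E)%E.
Proof.
have [F [dF F0 Foo]] := primitive_exprn_expRN n.
have cf : continuous (fun t : R => t ^+ n * expR (- t)).
  move=> t; apply: cvgM; first exact: exprn_continuous.
  apply: (@continuous_comp _ _ _ (fun t : R => - t) expR); first exact: opp_continuous.
  exact: continuous_expR.
have cF t : {for t, continuous F}.
  by apply: differentiable_continuous; apply/derivable1_diffP; have [] := dF t.
rewrite integral_itv_obnd_cbnd; last first.
  by apply/measurable_EFinP; apply: measurable_funTS; exact: continuous_measurable_fun.
rewrite (ge0_continuous_FTC2y (F := F) (l := 0)).
- by rewrite F0 -EFinB opprK add0r.
- by move=> t t0; rewrite mulr_ge0 ?exprn_ge0 ?expR_ge0.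
- exact: continuous_subspaceT.
- exact: Foo.
- by move=> t _; have [] := dF t.
- by apply: cvg_at_right_filter; exact: cF.
- by move=> t _; rewrite derive1E; exact: derive_val.
Qed.

Lemma integrable_exprn_expRN n : mu.-integrable pos (EFin \o (fun t => t ^+ n * expR (- t))).
Proof.
apply/integrableP; split.
  apply/measurable_EFinP; apply: measurable_funTS; apply: measurable_funM => //.
  by apply: measurableT_comp => //; exact: measurable_expR.
under eq_integral => t /set_mem/=.
  rewrite in_itv/= andbT => t0.
  rewrite ger0_norm; last by rewrite mulr_ge0 ?expR_ge0// exprn_ge0// ltW.
  over.
by rewrite integral_exprn_expRN ltry.
Qed.

(** The parabola is at most y and at most 1, its maximum at y = 2, while y^s is at least the smaller
    of y and 1. *)
Lemma powR_ge_parabola s y : 0 <= s -> s <= 1 -> 0 < y -> y - y ^+ 2 / 4 <= y `^ s.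
Proof.
move=> s0 s1 y0; have [y1|/ltW y1] := leP y 1.
  apply: (@le_trans _ _ y); first by have := sqr_ge0 y; lra.
  by apply: ger1_powR => //; rewrite y0.
apply: (@le_trans _ _ 1); first by have := sqr_ge0 (1 - y / 2); lra.
by rewrite -(powRr0 y) ler_powR.
Qed.

(* The parabola y - y^2/4 lies below y^s, and its moments against
   t^i exp(-t), y = t / i.+1, are factorials. *)
Lemma Gamma_ratio_lower i s : 0 <= s -> s <= 1 ->
  i.+1%:R `^ s / 2 <= Gamma (i%:R + (1 + s)) / i`!%:R.
Proof.
move=> s0 s1; pose M : R := i.+1%:R.
have M0 : 0 < M by rewrite ltr0n.
have f0 : 0 < i`!%:R :> R by rewrite ltr0n fact_gt0.
rewrite ler_pdivlMr// /Gamma.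
have ez t : 0 < t -> t `^ (i%:R + (1 + s) - 1) * expR (- t) = t `^ s * (t ^+ i * expR (- t)).
  move=> t0; rewrite (_ : i%:R + (1 + s) - 1 = i%:R + s); last by ring.
  by rewrite gt0_powRD// powR_mulrn ?ltW//; ring.
have mpos : measurable pos by exact: measurable_itv.
have i0 := integrable_exprn_expRN i; have i1 := integrable_exprn_expRN i.+1.
have i2 := integrable_exprn_expRN i.+2.
have iL : mu.-integrable pos (EFin \o (fun t => t `^ (i%:R + (1 + s) - 1) * expR (- t))).
  apply: (le_integrableR mpos (fun t => t ^+ i * expR (- t) + t ^+ i.+1 * expR (- t))).
  - apply: measurable_funM; first by apply: measurable_funTS; exact: measurable_powR.
    by apply: measurable_funTS; apply: measurableT_comp => //; exact: measurable_expR.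
  - move=> t /=; rewrite in_itv/= andbT => t0; rewrite ez//.
    have p0 : 0 <= t ^+ i * expR (- t) by rewrite mulr_ge0 ?expR_ge0// exprn_ge0// ltW.
    have p1 : 0 <= t ^+ i.+1 * expR (- t) by rewrite mulr_ge0 ?expR_ge0// exprn_ge0// ltW.
    have p2 : 0 <= t `^ s * (t ^+ i * expR (- t)) by rewrite mulr_ge0// powR_ge0.
    rewrite (ger0_norm p2) ger0_norm ?addr_ge0//.
    rewrite exprS -mulrA -[X in _ <= X + _]mul1r -mulrDl ler_wpM2r//.
    have [t1|/ltW t1] := leP t 1.
      apply: (@le_trans _ _ 1); last by rewrite lerDl ltW.
      have e1 : 1 `^ s = 1 :> R by rewrite powR1.
      by rewrite -e1 ge0_ler_powR// nnegrE ltW.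
    apply: (@le_trans _ _ t); last by rewrite lerDr.
    by apply: ler1_powR.
  - exact: (integrableRD mpos i0 i1).
have iR := integrableRZ mpos (M `^ s / M) i1.
have iR2 := integrableRZ mpos (M `^ s / (4 * M ^+ 2)) i2.
apply: (@le_trans _ _ (\int[mu]_(t in pos) (M `^ s / M * (t ^+ i.+1 * expR (- t))
   - M `^ s / (4 * M ^+ 2) * (t ^+ i.+2 * expR (- t))))); last first.
  apply: le_Rintegral => //; first exact: (integrableRB mpos iR iR2).
  move=> t /=; rewrite in_itv/= andbT => t0; rewrite ez//.
  have -> : M `^ s / M * (t ^+ i.+1 * expR (- t)) - M `^ s / (4 * M ^+ 2) * (t ^+ i.+2 * expR (- t))
     = M `^ s * ((t / M) - (t / M) ^+ 2 / 4) * (t ^+ i * expR (- t)).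
    by rewrite !exprS; field; rewrite gt_eqF.
  rewrite ler_wpM2r ?mulr_ge0 ?expR_ge0 ?exprn_ge0 ?(ltW t0)//.
  have -> : t `^ s = M `^ s * (t / M) `^ s.
    by rewrite -powRM ?(ltW M0) ?divr_ge0 ?ltW// mulrCA mulfV ?mulr1 ?gt_eqF.
  by rewrite ler_wpM2l ?powR_ge0// powR_ge_parabola// divr_gt0.
rewrite RintegralB// !RintegralZl// /Rintegral !integral_exprn_expRN/=.
have -> : i.+1`!%:R = M * i`!%:R :> R by rewrite factS natrM.
have -> : i.+2`!%:R = (M + 1) * (M * i`!%:R) :> R by rewrite !factS !natrM /M natr1.
have p0 := powR_gt0 s M0.
have M1 : 1 <= M by rewrite ler1n.
have -> : M `^ s / M * (M * i`!%:R) - M `^ s / (4 * M ^+ 2) * ((M + 1) * (M * i`!%:R)) =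
  (M `^ s * i`!%:R) * (1 - (M + 1) / (4 * M)) by field; rewrite gt_eqF.
rewrite mulrAC ler_wpM2l ?mulr_ge0 ?(ltW p0) ?(ltW f0)//.
(* The moments leave the factor 1 - (M+1)/(4M), and M >= 1 makes it at least 1/2. *)
rewrite -subr_ge0 (_ : _ - _ = (M - 1) / (4 * M)); last by field; rewrite gt_eqF.
by rewrite divr_ge0 ?subr_ge0// mulr_ge0// ltW.
Qed.

End gamma_bound.

(** * The sine quotient in lambda, bounded below uniformly in alpha *)

Section lambda_bound.
Context {R : realType}.
Implicit Types (alpha beta r x y : R).

(** With t = pi alpha/2 and p = pi (2 beta - alpha)/2, sum-to-product formulas turn the quotient
    into cos t / cos p and 2r - 1 into cot t tan p; then 1/cos^2 p = 1 + tan^2 p eliminates beta. *)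
Lemma sqr_sin_quotient alpha r beta : is_beta alpha r beta -> r != 0 ->
  (sin (pi * alpha) / (sin (pi * (alpha - beta)) + sin (pi * beta))) ^+ 2 =
  cos (pi * alpha / 2) ^+ 2 + (2 * r - 1) ^+ 2 * (1 - cos (pi * alpha / 2) ^+ 2).
Proof.
move=> [_ ->].
(* A zero denominator would make r equal to 0, because the inverse of 0 is 0. *)
set S := sin _ + _; have [->|S0] := eqVneq S 0; first by rewrite invr0 mulr0 eqxx.
move=> _; pose t := pi * alpha / 2; pose p := pi * (beta - (alpha - beta)) / 2.
have ea : pi * (alpha - beta) = t - p by rewrite /t /p; field.
have eb : pi * beta = t + p by rewrite /t /p; field.
have -> : sin (pi * alpha) = 2 * (sin t * cos t).
  by rewrite (_ : pi * alpha = t + t); [rewrite sinD; ring|rewrite /t; field].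
have eS : S = 2 * (sin t * cos p) by rewrite /S ea eb sinB sinD; ring.
rewrite -/t eb sinD -sin2cos2.
have e : 2 * ((sin t * cos p + cos t * sin p) / S) - 1 = 2 * (cos t * sin p) / S.
  have := S0; rewrite eS !mulf_eq0 pnatr_eq0/= negb_or => /andP[s0 p0].
  by field; rewrite s0 p0.
rewrite e !expr_div_n.
have -> : cos t ^+ 2 + (2 * (cos t * sin p)) ^+ 2 / S ^+ 2 * sin t ^+ 2 =
   (cos t ^+ 2 * S ^+ 2 + (2 * (cos t * sin p)) ^+ 2 * sin t ^+ 2) / S ^+ 2 by field.
congr (_ / _); rewrite eS.
transitivity ((2 * (sin t * cos t)) ^+ 2 * (cos p ^+ 2 + sin p ^+ 2)); last by ring.
by rewrite cos2Dsin2 mulr1.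
Qed.

(** The square is a convex combination of 1 and (2r-1)^2, so (2r-1)^2 serves when r > 1/2. At r =
    1/2 only cos^2(pi alpha/2) remains; the cosine is negative and decreasing between pi/2 and pi,
    so [alpha0] gives the smallest square. *)
Lemma sin_quotient_lower r alpha0 : 2^-1 <= r -> r <= 1 -> 1 < alpha0 ->
  exists2 kappa : R, 0 < kappa & forall alpha beta, alpha < 2 ->
    (r = 2^-1 -> alpha0 <= alpha) -> is_beta alpha r beta ->
    kappa <= (sin (pi * alpha) / (sin (pi * (alpha - beta)) + sin (pi * beta))) ^+ 2.
Proof.
move=> r2 r1 al0.
have r0 : r != 0 by rewrite gt_eqF// (lt_le_trans _ r2)// invr_gt0.
have [rh|rh] := eqVneq r 2^-1; last first.
  exists ((2 * r - 1) ^+ 2).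
    rewrite lt_neqAle sqr_ge0 andbT eq_sym expf_eq0/=.
    by apply: contra rh => /eqP h; apply/eqP; lra.
  move=> alpha beta _ _ hb; rewrite (sqr_sin_quotient _ _ _ hb r0).
  have c0 := sqr_ge0 (cos (pi * alpha / 2)).
  have q0 := sqr_ge0 (2 * r - 1).
  have q1 : (2 * r - 1) ^+ 2 <= 1 by rewrite expr_le1//; lra.
  nra.
(* If alpha0 >= 2, no alpha qualifies and any positive constant will do. *)
have [a2|a2] := leP 2 alpha0.
  exists 1 => // alpha beta h /(_ rh) h'; lra.
have p0 : 0 < pi :> R by exact: pi_gt0.
have c0 : cos (pi * alpha0 / 2) < 0.
  rewrite -cos_pihalf ltr_cos ?in_itv/=; [nra|nra|nra].
exists (cos (pi * alpha0 / 2) ^+ 2).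
  by rewrite exprn_even_gt0//= lt_eqF.
move=> alpha beta alt /(_ rh) ale hb; rewrite (sqr_sin_quotient _ _ _ hb r0) rh.
have -> : 2 * 2^-1 - 1 = 0 :> R by field.
rewrite expr0n/= mul0r addr0.
have h : cos (pi * alpha / 2) <= cos (pi * alpha0 / 2).
  have [->//|ne] := eqVneq alpha alpha0.
  have lt : alpha0 < alpha by rewrite lt_neqAle eq_sym ne.
  by apply: ltW; rewrite ltr_cos ?in_itv/=; nra.
nra.
Qed.

End lambda_bound.

(** * From weighted L^2 to L^1, and Fatou's lemma for weighted squares *)

Section weighted_estimates.
Context {R : realType}.
Local Notation mu := (@lebesgue_measure R).
Local Notation L1 f := (mu.-integrable unitI (EFin \o f)).
Implicit Types (a b x : R) (g : R -> R).

Lemma rhoN a b x : rho (- a) (- b) x = (rho a b x)^-1.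
Proof. by rewrite /rho !powRN invfM. Qed.

(** The arithmetic-geometric inequality for e rho and g^2/(e rho). The free e takes the place of
    Cauchy-Schwarz: a small e makes the first term small. *)
Lemma amgm_rho a b e g x : 0 < e -> unitI x ->
  `|g x| <= e * rho a b x + e^-1 * (rho (- a) (- b) x * g x ^+ 2).
Proof.
rewrite /unitI/= in_itv/= => e0 /andP[x0 x1].
have r0 : 0 < e * rho a b x by rewrite mulr_gt0// rho_gt0.
rewrite rhoN -(real_normK (num_real (g x))).
have -> : e^-1 * ((rho a b x)^-1 * `|g x| ^+ 2) = `|g x| ^+ 2 / (e * rho a b x).
  by rewrite (invfM e) mulrA mulrC.
move: (e * rho a b x) r0 (`|g x|) (normr_ge0 (g x)) => r r0 y y0.
have -> : r + y ^+ 2 / r = (r ^+ 2 + y ^+ 2) / r by field; rewrite gt_eqF.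
rewrite ler_pdivlMr//; have := sqr_ge0 (r - y); nra.
Qed.

(** In extended reals the right side may be +oo, so integrability of g can be deduced from its
    finiteness. *)
Lemma integral_norm_le_weighted a b e g : -1 < a -> -1 < b -> 0 < e ->
  measurable_fun unitI g ->
  (\int[mu]_(x in unitI) `|g x|%:E <=
   (e * \int[mu]_(x in unitI) rho a b x)%:E +
   e^-1%:E * \int[mu]_(x in unitI) (rho (- a) (- b) x * g x ^+ 2)%:E)%E.
Proof.
move=> a1 b1 e0 mg; have ir := integrable_rho a b a1 b1.
have p0 x : 0 <= rho (- a) (- b) x * g x ^+ 2 by rewrite mulr_ge0 ?rho_ge0 ?sqr_ge0.
have mp : measurable_fun unitI (fun x => rho (- a) (- b) x * g x ^+ 2).
  by apply: measurable_funM; [exact: measurable_rho|exact: measurable_funX].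
have mr : measurable_fun unitI (rho a b : R -> R) by exact: measurable_rho.
have -> : ((e * \int[mu]_(x in unitI) rho a b x)%:E =
    \int[mu]_(x in unitI) (e%:E * (rho a b x)%:E))%E.
  rewrite integralZl// EFinM; congr (_ * _)%E.
  by rewrite /Rintegral fineK//; exact: integrable_fin_num.
rewrite -ge0_integralZl//; last 3 first.
- exact/measurable_EFinP.
- by move=> x _; rewrite lee_fin.
- by rewrite lee_fin invr_ge0 ltW.
rewrite -ge0_integralD//; last 4 first.
- by move=> x _; rewrite -EFinM lee_fin mulr_ge0 ?rho_ge0// ltW.
- by apply/measurable_EFinP; exact: measurable_funM.
- by move=> x _; rewrite -EFinM lee_fin mulr_ge0 ?invr_ge0// ltW.
- by apply/measurable_EFinP; exact: measurable_funM.
apply: ge0_le_integral => //.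
- by apply/measurable_EFinP; exact: measurableT_comp.
- apply: emeasurable_funD; apply/measurable_EFinP; exact: measurable_funM.
- by move=> x xI; rewrite -!EFinM -EFinD lee_fin amgm_rho.
Qed.

Lemma integrable_of_L2 a b g : -1 < a -> -1 < b -> L2 (rho (- a) (- b)) g -> L1 g.
Proof.
move=> a1 b1 [mg fin]; apply/integrableP; split; first exact/measurable_EFinP.
apply: le_lt_trans (integral_norm_le_weighted a b 1 g a1 b1 ltr01 mg) _.
rewrite invr1 mul1r mul1e lte_add_pinfty ?ltry//.
move: fin; rewrite /wnorm; case: (\int[mu]_(_ in _) _)%E => //= r _; exact: ltry.
Qed.

Lemma fatou_sqr_weighted (w : R -> R) (U_ : nat -> R -> R) (U : R -> R) (B : \bar R) :
  measurable_fun unitI w -> (forall x, unitI x -> 0 <= w x) ->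
  (forall m, measurable_fun unitI (U_ m)) ->
  (forall x, unitI x -> U_ m x @[m --> \oo] --> U x) ->
  (forall m, (\int[mu]_(x in unitI) (w x * U_ m x ^+ 2)%:E <= B)%E) ->
  (\int[mu]_(x in unitI) (w x * U x ^+ 2)%:E <= B)%E.
Proof.
move=> mw w0 mU cU HB.
have -> : (\int[mu]_(x in unitI) (w x * U x ^+ 2)%:E =
   \int[mu]_(x in unitI) limn_einf (fun m => (w x * U_ m x ^+ 2)%:E))%E.
  apply: eq_integral => x /set_mem xI; apply/esym.
  apply: (cvg_limn_einf_sup _).1.
  apply: cvg_EFin; first exact: nearW.
  by apply: cvgMr; apply: cvgM; exact: cU.
have mf m : measurable_fun unitI (fun x => (w x * U_ m x ^+ 2)%:E).
  by apply/measurable_EFinP; apply: measurable_funM => //; exact: measurable_funX.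
have f0 m x : unitI x -> (0 <= (w x * U_ m x ^+ 2)%:E)%E.
  by move=> xI; rewrite lee_fin mulr_ge0 ?w0// sqr_ge0.
apply: le_trans (@fatou _ _ R mu unitI measurable_unitI _ mf f0) _.
rewrite limn_einf_lim; apply: lime_le; first exact: is_cvg_einfs.
apply: nearW => m; apply: le_trans (HB m); apply: ereal_inf_lbound.
by exists m => /=.
Qed.

End weighted_estimates.

(** * One term of the error against one energy of f *)

Section term_bound.
Context {R : realType}.
Local Notation mu := (@lebesgue_measure R).
Local Notation L1 f := (mu.-integrable unitI (EFin \o f)).
Implicit Types (alpha beta kappa : R) (f : R -> R) (n i : nat).

Lemma fcoef_sqr alpha beta f i :
  fcoef alpha beta f i ^+ 2 / Gnorm i (beta - 1) (alpha - beta - 1) ^+ 2 =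
  jacobi_energy i (beta - 1) (alpha - beta - 1) f.
Proof.
rewrite /jacobi_energy /fcoef; congr (_ ^+ 2 / _).
by apply: eq_Rintegral => x _; exact: mulrAC.
Qed.

Lemma jacobi_energy_ge0 n (a b : R) f : 0 <= jacobi_energy n a b f.
Proof. by rewrite divr_ge0 ?sqr_ge0. Qed.

(** Two uses of [Gnorm_succ] with [Gnorm_sym] in between: the swap takes place at (alpha-beta,
    beta), where both parameters are positive. *)
Lemma Gnorm_shift alpha beta n : 0 < alpha - beta -> 0 < beta ->
  (n.+1%:R + alpha + 1) * (n.+1%:R + alpha) * Gnorm n (alpha - beta + 1) (beta + 1) ^+ 2 =
  n.+1%:R * n.+2%:R * Gnorm n.+2 (beta - 1) (alpha - beta - 1) ^+ 2.
Proof.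
move=> a0 b0; have a1 : -1 < alpha - beta by lra.
have b1 : -1 < beta by lra.
have a2 : -1 < alpha - beta - 1 by lra.
have b2 : -1 < beta - 1 by lra.
have e1 := Gnorm_succ n _ _ a1 b1; have e2 := Gnorm_succ n.+1 _ _ b2 a2.
rewrite !subrK (Gnorm_sym n.+1 beta)// in e2.
rewrite -[RHS]mulrA e2 [RHS]mulrCA e1.
have -> : n.+2%:R + (beta - 1) + (alpha - beta - 1) + 1 = n.+1%:R + alpha by rewrite -natr1; ring.
have -> : n.+1%:R + (alpha - beta) + beta + 1 = n.+1%:R + alpha + 1 by ring.
by ring.
Qed.

Lemma lambda_sqr_lower alpha beta kappa i : 1 <= alpha -> alpha <= 2 -> 0 <= kappa ->
  kappa <= (sin (pi * alpha) / (sin (pi * (alpha - beta)) + sin (pi * beta))) ^+ 2 ->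
  kappa / 4 * (i.+1%:R `^ (alpha - 1)) ^+ 2 <= lambda alpha beta i ^+ 2.
Proof.
move=> a1 a2 k0 hk.
have s0 : 0 <= alpha - 1 by lra.
have s1 : alpha - 1 <= 1 by lra.
have := Gamma_ratio_lower i (alpha - 1) s0 s1.
rewrite (_ : 1 + (alpha - 1) = alpha); last by ring.
move=> hG.
rewrite /lambda exprMn.
have p0 : 0 <= i.+1%:R `^ (alpha - 1) / 2 :> R by rewrite divr_ge0 ?powR_ge0.
have -> : kappa / 4 * (i.+1%:R `^ (alpha - 1)) ^+ 2 = kappa * (i.+1%:R `^ (alpha - 1) / 2) ^+ 2 by field.
by apply: ler_pM; rewrite ?sqr_ge0// lerXn2r ?nnegrE// (le_trans p0).
Qed.

(** The division by n+1 comes from integrating rho G_(n+1), and c_(n+1) is built on f_(n+2), whence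
    degree n+2. The norm ratio from [Gnorm_shift] is at most 1, and the remaining (n+1)^-2 and
    lambda_(n+1)^-2 are bounded by means of N <= n+1. *)
Lemma solution_term_bound alpha beta kappa f n N : 1 < alpha -> alpha < 2 ->
  0 < alpha - beta -> 0 < beta -> 0 < kappa -> (1 <= N)%N -> (N <= n.+1)%N ->
  kappa <= (sin (pi * alpha) / (sin (pi * (alpha - beta)) + sin (pi * beta))) ^+ 2 ->
  (c alpha beta f n.+1 / n.+1%:R) ^+ 2 * Gnorm n (alpha - beta + 1) (beta + 1) ^+ 2 <=
  4 / (kappa * N%:R ^+ 2 * (N.+1%:R `^ (alpha - 1)) ^+ 2)
  * jacobi_energy n.+2 (beta - 1) (alpha - beta - 1) f.
Proof.
move=> a1 a2 pa pb k0 N1 Nn hk.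
have hl := lambda_sqr_lower alpha beta kappa n.+1 (ltW a1) (ltW a2) (ltW k0) hk.
have hG := Gnorm_shift alpha beta n pa pb.
rewrite /c -fcoef_sqr.
have N0 : 0 < N%:R :> R by rewrite ltr0n.
have Nn' : N%:R <= n.+1%:R :> R by rewrite ler_nat.
have n0 : 0 < n.+1%:R :> R by rewrite ltr0n.
have P0 : 0 < N.+1%:R `^ (alpha - 1) :> R by rewrite powR_gt0.
have PP : N.+1%:R `^ (alpha - 1) <= n.+2%:R `^ (alpha - 1) :> R.
  rewrite ge0_ler_powR ?nnegrE ?ler0n ?ler_nat//; lra.
set G := Gnorm n.+2 _ _ in hG *; set F := fcoef _ _ _ _.
set G' := Gnorm n _ _ ^+ 2 in hG *.
set l := lambda _ _ _ in hl *.
set P := N.+1%:R `^ _ in P0 PP *.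
have hl' : kappa / 4 * P ^+ 2 <= l ^+ 2.
  apply: le_trans hl; rewrite ler_wpM2l ?divr_ge0 ?(ltW k0)//.
  by rewrite lerXn2r ?nnegrE ?powR_ge0// ltW.
have kP : 0 < kappa / 4 * P ^+ 2 by rewrite mulr_gt0 ?exprn_gt0// divr_gt0.
have l0 : 0 < l ^+ 2 by apply: lt_le_trans hl'.
have d1 : 0 < n.+1%:R + alpha by lra.
have d2 : 0 < n.+1%:R + alpha + 1 by lra.
have -> : G' = n.+1%:R * n.+2%:R * G ^+ 2 / ((n.+1%:R + alpha + 1) * (n.+1%:R + alpha)).
  by rewrite -hG mulrC mulKf// mulf_neq0 ?gt_eqF.
have [G0|G0] := eqVneq G 0.
  by rewrite G0 expr0n/= !mulr0 !mul0r invr0 !mulr0.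
have ln0 : l != 0 by apply: contraTneq l0 => ->; rewrite expr0n/= ltxx.
have -> : (F / (l * G ^+ 2) / n.+1%:R) ^+ 2 *
   (n.+1%:R * n.+2%:R * G ^+ 2 / ((n.+1%:R + alpha + 1) * (n.+1%:R + alpha))) =
   (n.+2%:R * n.+1%:R / ((n.+1%:R + alpha + 1) * (n.+1%:R + alpha))) *
   ((l ^+ 2)^-1 * ((n.+1%:R ^+ 2)^-1 * (F ^+ 2 / G ^+ 2))).
  move: (n.+2%:R : R) (n.+1%:R : R) n0 d1 d2 => m p p0 d1 d2.
  by field; rewrite G0 ln0 !gt_eqF.
have E0 : 0 <= F ^+ 2 / G ^+ 2 by rewrite divr_ge0 ?sqr_ge0.
apply: (@le_trans _ _ ((l ^+ 2)^-1 * ((n.+1%:R ^+ 2)^-1 * (F ^+ 2 / G ^+ 2)))).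
  rewrite ler_piMl//.
    by rewrite mulr_ge0 ?invr_ge0 ?sqr_ge0// mulr_ge0 ?invr_ge0 ?sqr_ge0.
  rewrite ler_pdivrMr ?mulr_gt0// mul1r; by apply: ler_pM => //; lra.
have -> : 4 / (kappa * N%:R ^+ 2 * P ^+ 2) * (F ^+ 2 / G ^+ 2) =
  (kappa / 4 * P ^+ 2)^-1 * ((N%:R ^+ 2)^-1 * (F ^+ 2 / G ^+ 2)).
  move: (N%:R : R) N0 {hl hl' PP Nn'} => m m0.
  by field; rewrite G0 !gt_eqF.
apply: ler_pM; rewrite ?invr_ge0 ?sqr_ge0//.
- by rewrite mulr_ge0 ?invr_ge0 ?sqr_ge0.
- by rewrite lef_pV2.
- by rewrite ler_wpM2r// lef_pV2 ?posrE ?exprn_gt0// lerXn2r ?nnegrE ?ler0n.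
Qed.

End term_bound.

(** * The tail of the expansion of f *)

Section energy_tail.
Context {R : realType}.
Local Notation mu := (@lebesgue_measure R).
Local Notation L1 f := (mu.-integrable unitI (EFin \o f)).
Implicit Types (a b alpha beta : R) (f g : R -> R).

Lemma Dn_spec s f : has_Dn s f -> is_Dn s f (Dn s f).
Proof. by move=> [g fg]; exact: (xgetPex (fun=> 0) (ex_intro [set g | is_Dn s f g] g fg)). Qed.

(** The chain in [is_Dn] starts at a representative that equals f only almost everywhere. *)
Lemma jacobi_energy_ae n a b f g : measurable_fun unitI f ->
  L1 (fun x => rho a b x * g x) ->
  {ae mu, forall x, unitI x -> g x = f x} ->
  jacobi_energy n a b g = jacobi_energy n a b f.
Proof.
move=> mf ig ae; rewrite /jacobi_energy /Rintegral; congr (fine _ ^+ 2 / _).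
have ig' := integrable_mul_jacobiG _ n a b ig.
apply: ae_eq_integral => //.
- have := measurable_integrableR ig'; move=> h; apply/measurable_EFinP.
  by apply: eq_measurable_fun h => x _; ring.
- apply/measurable_EFinP; apply: measurable_funM => //; apply: measurable_funM.
    exact: measurable_rho.
  by apply: measurable_funTS; apply: continuous_measurable_fun; exact: jacobiG_continuous.
- case: ae => E [mE E0 sE]; exists E; split=> // x nx; apply: sE => /= h.
  by apply: nx => xI; rewrite h.
Qed.

Lemma L2_integrable_sqr a b g : L2 (rho a b) g -> L1 (fun x => rho a b x * g x ^+ 2).
Proof.
move=> [mg fin]; apply/integrableP; split.
  apply/measurable_EFinP; apply: measurable_funM; first exact: measurable_rho.
  exact: measurable_funX.
under eq_integral => x _.
  rewrite gee0_abs; last by rewrite lee_fin mulr_ge0 ?rho_ge0 ?sqr_ge0.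
  over.
rewrite /=.
move: fin; rewrite /wnorm; case: (\int[mu]_(_ in _) _)%E => //= r _; exact: ltry.
Qed.

(** Since j <= N+1, every degree N+k+1 survives j derivatives and becomes N+1-j+k, so Bessel's
    inequality applies from degree N+1-j on. The number alpha-1 is the sum of the two parameters
    plus 1. *)
Lemma energy_tail_bound alpha beta f j N m : 1 < alpha -> 0 < alpha - beta -> 0 < beta ->
  measurable_fun unitI f -> has_Dn j f ->
  L2 (rho (beta - 1 + j%:R) (alpha - beta - 1 + j%:R)) (Dn j f) ->
  (1 <= N)%N -> (j <= N.+1)%N ->
  \sum_(k < m) jacobi_energy (N + k).+1 (beta - 1) (alpha - beta - 1) f <=
  j%:R ^+ j / (N%:R * (N%:R + alpha - 1)) ^+ j *
  \int[mu]_(x in unitI) (rho (beta - 1 + j%:R) (alpha - beta - 1 + j%:R) x * Dn j f x ^+ 2).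
Proof.
move=> a1 pa pb mf /Dn_spec[F [F0 DF Fj]] L2D N1 jN.
set A := beta - 1; set B := alpha - beta - 1.
have A1 : -1 < A by rewrite /A; lra.
have B1 : -1 < B by rewrite /B; lra.
have j0 : 0 <= j%:R :> R by rewrite ler0n.
have Aj : -1 < A + j%:R by lra.
have Bj : -1 < B + j%:R by lra.
have mD := L2D.1; have i2 := L2_integrable_sqr _ _ _ L2D.
have i1 := integrable_rho_of_sqr Aj Bj _ mD i2.
have iF : L1 (fun x => rho (A + j%:R) (B + j%:R) x * F j x) by rewrite Fj.
have iF0 : L1 (fun x => rho A B x * F 0%N x).
  by have [] := jacobi_energy_iter _ _ _ _ j A1 B1 DF iF (leqnn j).
set X := (_ * _) ^+ j.
have N0 : 0 < N%:R :> R by rewrite ltr0n.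
have X0 : 0 < X by rewrite exprn_gt0// mulr_gt0//; lra.
have jj0 : 0 <= j%:R ^+ j :> R by rewrite exprn_ge0.
have term k : jacobi_energy (N + k).+1 A B f <=
    j%:R ^+ j / X * jacobi_energy (N.+1 - j + k) (A + j%:R) (B + j%:R) (Dn j f).
  have jn : (j <= (N + k).+1)%N by rewrite (leq_trans jN)// ltnS leq_addr.
  have [_ e] := jacobi_energy_iter _ _ _ _ (N + k).+1 A1 B1 DF iF jn.
  rewrite -(jacobi_energy_ae _ _ _ _ _ mf iF0 F0).
  have -> : (N.+1 - j + k = (N + k).+1 - j)%N by rewrite addnBAC.
  rewrite -Fj -e; set Pr := \prod_(i < j) _.
  set E := jacobi_energy _ _ _ _; have E0 : 0 <= E by exact: jacobi_energy_ge0.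
  have s0 : 0 <= alpha - 1 by lra.
  have Nn : (N <= (N + k).+1)%N by rewrite leqW// leq_addr.
  have hP : X <= j%:R ^+ j * Pr.
    have := prod_energy_lower _ _ _ _ Nn jn s0.
    rewrite /X -addrA => /le_trans; apply.
    rewrite le_eqVlt; apply/orP; left; apply/eqP; congr (_ * _); apply: eq_bigr => i _.
    by rewrite /A /B; ring.
  have -> : j%:R ^+ j / X * (E * Pr) = (j%:R ^+ j * Pr * E) / X by ring.
  by rewrite ler_pdivlMr// mulrC ler_wpM2r.
apply: (@le_trans _ _ (\sum_(k < m) j%:R ^+ j / X * jacobi_energy (N.+1 - j + k) (A + j%:R) (B + j%:R) (Dn j f))).
  by apply: ler_sum => k _.
rewrite -big_distrr/= ler_wpM2l//; first by rewrite divr_ge0// ltW.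
exact: bessel_jacobi.
Qed.

End energy_tail.

(** * Means of q and q_N, and the integrated difference of two q_N *)

Section error_representation.
Context {R : realType}.
Local Notation mu := (@lebesgue_measure R).
Local Notation L1 f := (mu.-integrable unitI (EFin \o f)).
Context {alpha r beta : R}.
Hypotheses (a0 : 0 < alpha - beta) (b0 : 0 < beta).
Implicit Types (f q u : R -> R) (K : R).

Let a1 : -1 < alpha - beta. Proof. by have := a0; lra. Qed.
Let b1 : -1 < beta. Proof. by have := b0; lra. Qed.

Let p f x := cN1 alpha r beta f * x * k alpha beta x.

Lemma integrable_k : L1 (k alpha beta).
Proof. by apply: (@integrable_rho R (alpha - beta - 1) (beta - 1)); have := a0; have := b0; lra. Qed.

(** A zero integral would force k = 0 almost everywhere, yet k > 0 on an interval of measure 1.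
    Positivity is what determines c_(-2). *)
Lemma integral_k_gt0 : 0 < \int[mu]_(x in unitI) k alpha beta x.
Proof.
rewrite lt_neqAle Rintegral_ge0 ?andbT; last by move=> x _; exact: rho_ge0.
apply/negP => /eqP e.
have h : (\int[mu]_(x in unitI) `|(EFin \o k alpha beta) x| = 0)%E.
  transitivity (\int[mu]_(x in unitI) (k alpha beta x)%:E)%E.
    by apply: eq_integral => x _; rewrite /= ger0_norm//; exact: rho_ge0.
  have fi := integrable_fin_num measurable_unitI integrable_k.
  by rewrite -(fineK fi) -[fine _]/(Rintegral mu unitI (k alpha beta)) -e.
have := (ae_eq_integral_abs mu measurable_unitI (measurable_int _ integrable_k)).1 h.
move=> [E [mE E0 sE]].
have sub : unitI `<=` E.
  move=> x xI; apply: sE => /= /(_ xI) [] kx.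
  move: xI; rewrite /unitI/= in_itv/= => /andP[x0 x1].
  by have := rho_gt0 (alpha - beta - 1) (beta - 1) x x0 x1; rewrite [rho _ _ _]kx ltxx.
have : (mu unitI <= 0)%E by rewrite -E0; apply: le_measure => //; rewrite inE.
by rewrite /unitI lebesgue_measure_itv/= lte_fin ltr01 oppr0 adde0 leNgt lte01.
Qed.

Let integrable_p f : L1 (p f).
Proof.
apply: (le_integrableR measurable_unitI (fun x => cN1 alpha r beta f * k alpha beta x)).
- apply: measurable_funM; last exact: (@measurable_rho R (alpha - beta - 1) (beta - 1)).
  exact: measurable_funM.
- move=> x; rewrite /unitI/= in_itv/= => /andP[x0 x1].
  rewrite /p !normrM ler_wpM2r// ler_piMr// ger0_norm; lra.
- exact: (integrableRZ measurable_unitI _ integrable_k).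
Qed.

Let S f M x := \sum_(i < M) c alpha beta f i * jacobiG i (alpha - beta) beta x.

Let integrable_S f M : L1 (fun x => rho (alpha - beta) beta x * S f M x).
Proof.
apply: (integrable_lincomb _ (fun i => jacobiG i (alpha - beta) beta)) => i _.
exact: integrable_rho_jacobiG.
Qed.

Lemma integrable_qN f M : L1 (qN alpha r beta f M).
Proof. exact: (integrableRD measurable_unitI (integrable_p f) (integrable_S f M)). Qed.

Let integrable_e f q : is_q alpha r beta f q -> L1 (fun x => q x - p f x).
Proof. by case=> L2q _; exact: integrable_of_L2 a1 b1 L2q. Qed.

Lemma integrable_q f q : is_q alpha r beta f q -> L1 q.
Proof.
move=> /integrable_e ie; have := integrableRD measurable_unitI ie (integrable_p f).
by apply: eq_integrable => // x _ /=; rewrite subrK.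
Qed.

Lemma qN_cvg_L1 f q eta : is_q alpha r beta f q -> 0 < eta ->
  \forall M \near \oo,
    \int[mu]_(x in unitI) `|q x - qN alpha r beta f M x| <= eta.
Proof.
move=> Hq eta0; have [L2q cq] := Hq.
pose A := \int[mu]_(x in unitI) rho (alpha - beta) beta x.
have A0 : 0 <= A by apply: Rintegral_ge0 => x _; exact: rho_ge0.
(* Once the weighted norm is below e, the bound is e A + e^-1 e^2 = e (A+1) = eta. *)
pose e := eta / (A + 1).
have e0 : 0 < e by rewrite divr_gt0// ltr_wpDl.
have [fin cfin] := (fine_cvgP _ _).1 cq.
have lt := cvgr_lt _ cfin _ e0.
near=> M.
have finM : wnorm (rho (- (alpha - beta)) (- beta))
   ((qN alpha r beta f M \- p f) \- (q \- p f)) \is a fin_num by near: M; exact: fin.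
have ltM : fine (wnorm (rho (- (alpha - beta)) (- beta))
   ((qN alpha r beta f M \- p f) \- (q \- p f))) < e by near: M; exact: lt.
set g := (_ \- _) in finM ltM.
have mg : measurable_fun unitI g.
  apply: measurable_funB; last exact: L2q.1.
  by apply: measurable_funB; apply: measurable_integrableR; [exact: integrable_qN|exact: integrable_p].
have ig : L1 (fun x => q x - qN alpha r beta f M x).
  exact: (integrableRB measurable_unitI (integrable_q _ _ Hq) (integrable_qN f M)).
have X0 : (0 <= \int[mu]_(x in unitI) (rho (- (alpha - beta)) (- beta) x * g x ^+ 2)%:E)%E.
  by apply: integral_ge0 => x _; rewrite lee_fin mulr_ge0 ?rho_ge0 ?sqr_ge0.
have X1 : (\int[mu]_(x in unitI) (rho (- (alpha - beta)) (- beta) x * g x ^+ 2)%:E <= (e ^+ 2)%:E)%E.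
  move: finM ltM X0; rewrite /wnorm; case: (\int[mu]_(_ in _) _)%E => //= X _ Xe.
  rewrite !lee_fin => X0; rewrite -(sqr_sqrtr X0).
  by rewrite lerXn2r ?nnegrE ?sqrtr_ge0// ltW.
rewrite -lee_fin /Rintegral fineK; last first.
  by apply: integrable_fin_num => //; exact: (integrableR_norm _ ig).
have -> : (\int[mu]_(x in unitI) `|q x - qN alpha r beta f M x|%:E =
    \int[mu]_(x in unitI) `|g x|%:E)%E.
  by apply: eq_integral => x _; rewrite /g/= distrC; congr (`|_|%:E); ring.
apply: le_trans (integral_norm_le_weighted (alpha - beta) beta e g a1 b1 e0 mg) _.
apply: (@le_trans _ _ ((e * A)%:E + e^-1%:E * (e ^+ 2)%:E)%E).
  by rewrite leeD2l// lee_wpmul2l// lee_fin invr_ge0 ltW.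
rewrite -EFinM -EFinD lee_fin expr2 mulKf ?gt_eqF// -[X in _ + X]mulr1 -mulrDr.
by rewrite divfK// gt_eqF// ltr_wpDl.
Unshelve. all: by end_near. Qed.

(** Only G_0 has a nonzero mean against rho, so the mean of q_M is the same for all M >= 1, once the
    term c_0 is present. *)
Lemma integral_qN f M : (1 <= M)%N ->
  \int[mu]_(x in unitI) qN alpha r beta f M x =
  \int[mu]_(x in unitI) p f x +
  c alpha beta f 0 * \int[mu]_(x in unitI) rho (alpha - beta) beta x.
Proof.
case: M => // M _.
transitivity (\int[mu]_(x in unitI) (p f x + rho (alpha - beta) beta x * S f M.+1 x)) => //.
rewrite RintegralD//; congr (_ + _).
rewrite (Rintegral_lincomb _ (fun i => jacobiG i (alpha - beta) beta)); last first.
  by move=> i _; exact: integrable_rho_jacobiG.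
rewrite big_ord_recl big1 ?addr0.
  by congr (_ * _); apply: eq_Rintegral => x _; rewrite jacobiG0 mulr1.
by move=> i _; rewrite integral_rho_jacobiG0 ?mulr0.
Qed.

Lemma integral_q f q N : is_q alpha r beta f q -> (1 <= N)%N ->
  \int[mu]_(x in unitI) q x = \int[mu]_(x in unitI) qN alpha r beta f N x.
Proof.
move=> Hq N1; have iq := integrable_q _ _ Hq.
apply/eqP; rewrite -subr_eq0 -normr_le0; apply/ler_addgt0Pl => eta eta0.
rewrite addr0.
near \oo => M.
have M1 : (1 <= M)%N by near: M; exact: nbhs_infty_ge.
have -> : \int[mu]_(x in unitI) qN alpha r beta f N x = \int[mu]_(x in unitI) qN alpha r beta f M x.
  by rewrite !integral_qN.
rewrite -RintegralB//; last exact: integrable_qN.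
apply: le_trans (le_normr_Rintegral measurable_unitI _) _.
  exact: (integrableRB measurable_unitI iq (integrable_qN f M)).
near: M; exact: qN_cvg_L1.
Unshelve. all: by end_near. Qed.

Lemma is_cN2E K q c2 : K != 0 -> L1 q -> is_cN2 alpha beta (cst K) q c2 ->
  c2 = - (\int[mu]_(x in unitI) q x) / \int[mu]_(x in unitI) k alpha beta x.
Proof.
move=> K0 iq; rewrite /is_cN2.
have ik := integrableRZ measurable_unitI c2 integrable_k.
have ikq := integrableRD measurable_unitI ik iq.
have -> : \int[mu]_(s in unitI) ((c2 * k alpha beta s + q s) / cst K s) =
  K^-1 * \int[mu]_(s in unitI) (c2 * k alpha beta s + q s).
  by rewrite -RintegralZl//; apply: eq_Rintegral => x _; rewrite mulrC.
have -> : \int[mu]_(s in unitI) (c2 * k alpha beta s + q s) =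
    c2 * \int[mu]_(x in unitI) k alpha beta x + \int[mu]_(x in unitI) q x.
  by rewrite RintegralD//; congr (_ + _); rewrite RintegralZl//; exact: integrable_k.
move/eqP; rewrite mulf_eq0 invr_eq0 (negbTE K0)/= addr_eq0 => /eqP e.
apply: (@mulIf _ (\int[mu]_(x in unitI) k alpha beta x)).
  by rewrite gt_eqF// integral_k_gt0.
by rewrite e divfK// gt_eqF// integral_k_gt0.
Qed.

Let sub0x x : unitI x -> (`]0, x[ : set R) `<=` unitI.
Proof.
rewrite /unitI/= in_itv/= => /andP[_ x1] y; rewrite /= !in_itv/= => /andP[-> yx].
exact: lt_trans yx x1.
Qed.

Let integrable_0x g x : unitI x -> L1 g -> mu.-integrable `]0, x[ (EFin \o g).
Proof. by move=> xI; apply: integrableS => //; exact: sub0x. Qed.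

Lemma primitive_sub K q q' c2 x : L1 q -> L1 q' -> unitI x ->
  primitive alpha beta (cst K) q c2 x - primitive alpha beta (cst K) q' c2 x =
  - (K^-1 * \int[mu]_(s in `]0, x[) (q s - q' s)).
Proof.
move=> iq iq' xI; rewrite /primitive.
have ik := integrableRZ measurable_unitI c2 integrable_k.
have E g : L1 g -> \int[mu]_(s in `]0, x[) ((c2 * k alpha beta s + g s) / cst K s) =
    K^-1 * (\int[mu]_(s in `]0, x[) (c2 * k alpha beta s) + \int[mu]_(s in `]0, x[) g s).
  move=> ig; rewrite -RintegralD//; try exact: integrable_0x.
  rewrite -RintegralZl//; first by apply: eq_Rintegral => y _; rewrite mulrC.
  by apply: integrable_0x => //; exact: integrableRD.
rewrite !E// RintegralB//; try exact: integrable_0x.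
by ring.
Qed.

Lemma qN_sub f N m x : qN alpha r beta f (N + m) x - qN alpha r beta f N x =
  rho (alpha - beta) beta x *
    \sum_(i < m) c alpha beta f (N + i) * jacobiG (N + i) (alpha - beta) beta x.
Proof. by rewrite /qN big_split_ord/= mulrDr; ring. Qed.

(** Starting at N.+1 keeps all degrees positive, so each term has its primitive from Rodrigues'
    formula: raised weight, degree lowered by one, coefficient divided by the degree. *)
Lemma integral_qN_sub f N m x : unitI x ->
  \int[mu]_(s in `]0, x[) (qN alpha r beta f (N.+1 + m) s - qN alpha r beta f N.+1 s) =
  - (rho (alpha - beta + 1) (beta + 1) x *
     \sum_(i < m) c alpha beta f (N + i).+1 / (N + i).+1%:R *
       jacobiG (N + i) (alpha - beta + 1) (beta + 1) x).
Proof.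
move=> xI; have /andP[x0 x1] : 0 < x < 1 by move: xI; rewrite /unitI/= in_itv.
under eq_Rintegral => s _ do rewrite qN_sub big_distrr/=.
rewrite (@Rintegral_sum R _ _ m (fun i s => rho (alpha - beta) beta s *
  (c alpha beta f (N.+1 + i) * jacobiG (N.+1 + i) (alpha - beta) beta s)))//; last first.
  move=> i _; apply: integrable_0x => //.
  have := integrableRZ measurable_unitI (c alpha beta f (N.+1 + i)) (integrable_rho_jacobiG a1 b1 (N.+1 + i) (alpha - beta) beta).
  by apply: eq_integrable => // s _ /=; congr _%:E; ring.
rewrite big_distrr -sumrN/=; apply: eq_bigr => i _.
transitivity (\int[mu]_(s in `]0, x[) (c alpha beta f (N.+1 + i) *
   (rho (alpha - beta) beta s * jacobiG (N.+1 + i) (alpha - beta) beta s))).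
  by apply: eq_Rintegral => s _; ring.
rewrite RintegralZl//; last by apply: integrable_0x => //; exact: integrable_rho_jacobiG.
rewrite addSn integral_rho_jacobiG//; ring.
Qed.

End error_representation.

(** * The bound on the squared error *)

Section error_bound.
Context {R : realType}.
Local Notation mu := (@lebesgue_measure R).
Local Notation L1 f := (mu.-integrable unitI (EFin \o f)).
Context {alpha r beta : R}.
Implicit Types (f q u : R -> R) (K : R).

(** Up to the factor 1/K, the difference of the primitives of q_(N+1+m) and q_(N+1) taken with the
    same c_(-2). *)
Let approximant f N m x :=
  rho (alpha - beta + 1) (beta + 1) x *
     \sum_(i < m) c alpha beta f (N + i).+1 / (N + i).+1%:R *
       jacobiG (N + i) (alpha - beta + 1) (beta + 1) x.

Lemma error_cvg f q K c2 N x : 0 < alpha - beta -> 0 < beta -> 0 < K ->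
  is_q alpha r beta f q -> unitI x ->
  K^-1 * approximant f N m x @[m --> \oo] -->
  primitive alpha beta (cst K) q c2 x -
  primitive alpha beta (cst K) (qN alpha r beta f N.+1) c2 x.
Proof.
move=> a0 b0 K0 Hq xI.
have iq := integrable_q a0 b0 _ _ Hq.
have iN M := integrable_qN (r := r) a0 b0 f M.
have sub : (`]0, x[ : set R) `<=` unitI.
  move: xI; rewrite /unitI/= in_itv/= => /andP[_ x1] y; rewrite /= !in_itv/= => /andP[-> yx].
  exact: lt_trans yx x1.
have i0 g : L1 g -> mu.-integrable `]0, x[ (EFin \o g) by apply: integrableS.
rewrite primitive_sub//.
apply/cvgrPdist_le => /= eta eta0.
(* The tolerance K eta absorbs the factor 1/K. The L^1 distance on (0,1) then controls the integral
   up to any x. *)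
have Keta : 0 < K * eta by rewrite mulr_gt0.
have near_qN := qN_cvg_L1 a0 b0 f q _ Hq Keta.
have : \forall m \near \oo, \int[mu]_(y in unitI) `|q y - qN alpha r beta f (N.+1 + m) y| <= K * eta.
  case: near_qN => M0 _ HM; exists M0 => // m /= M0m; apply: HM => /=.
  by rewrite (leq_trans M0m)// leq_addl.
apply: filterS => m hm.
have igm := integrableRB measurable_unitI iq (iN (N.+1 + m)%N).
have e := integral_qN_sub (r := r) a0 b0 f N m x xI.
have -> : - (K^-1 * \int[mu]_(s in `]0, x[) (q s - qN alpha r beta f N.+1 s)) -
    K^-1 * approximant f N m x =
  - (K^-1 * \int[mu]_(s in `]0, x[) (q s - qN alpha r beta f (N.+1 + m) s)).
  have -> : approximant f N m x =
      - \int[mu]_(s in `]0, x[) (qN alpha r beta f (N.+1 + m) s - qN alpha r beta f N.+1 s).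
    by rewrite e opprK.
  by rewrite !RintegralB//; try exact: i0; ring.
rewrite normrN normrM gtr0_norm ?invr_gt0// ler_pdivrMl//.
apply: le_trans (le_normr_Rintegral _ _) _ => //; first exact: i0.
apply: le_trans hm; rewrite /Rintegral.
have iA := integrableR_norm _ igm.
apply: fine_le; [exact: (integrable_fin_num _ (i0 _ iA))|exact: integrable_fin_num|].
apply: ge0_subset_integral => //.
exact: measurable_int iA.
Qed.

(** The inverse weight cancels one of the two factors [rho (alpha - beta + 1) (beta + 1)] in the
    square, leaving the weight for which the lowered polynomials are orthogonal. *)
Lemma integral_approximant f N m K : 0 < alpha - beta -> 0 < beta ->
  (\int[mu]_(x in unitI) (rho (- (alpha - beta + 1)) (- (beta + 1)) x *
     (K^-1 * approximant f N m x) ^+ 2)%:E =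
  (K ^- 2 * \sum_(i < m) (c alpha beta f (N + i).+1 / (N + i).+1%:R) ^+ 2 *
    Gnorm (N + i) (alpha - beta + 1) (beta + 1) ^+ 2)%:E)%E.
Proof.
move=> a0 b0; have a1 : -1 < alpha - beta + 1 by lra.
have b1 : -1 < beta + 1 by lra.
pose d k := c alpha beta f (N + k).+1 / (N + k).+1%:R.
pose S x := \sum_(i < m) d i * jacobiG (N + i) (alpha - beta + 1) (beta + 1) x.
have iS : L1 (fun x => rho (alpha - beta + 1) (beta + 1) x * S x).
  by apply: (integrable_lincomb (rho _ _) (fun k => jacobiG (N + k) _ _)) => k _;
     exact: integrable_rho_jacobiG.
have iSS : L1 (fun x => rho (alpha - beta + 1) (beta + 1) x * S x * S x).
  apply: (integrable_lincomb (fun x => rho _ _ x * S x) (fun k => jacobiG (N + k) _ _)) => k _.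
  exact: integrable_mul_jacobiG.
rewrite -(integral_sqr_lincomb a1 b1 d N m) -RintegralZl//; last first.
  by apply: eq_integrable iSS => // x _ /=; congr _%:E; rewrite -/(S x); ring.
rewrite /Rintegral fineK.
  apply: eq_integral => x /set_mem; rewrite /unitI/= in_itv/= => /andP[x0 x1].
  congr _%:E; rewrite rhoN /approximant -/(S x) -exprVn.
  have := rho_gt0 (alpha - beta + 1) (beta + 1) x x0 x1.
  move: (rho _ _ x) (K^-1) => t z t0.
  by field; rewrite gt_eqF.
apply: integrable_fin_num => //.
have := integrableRZ measurable_unitI (K ^- 2) iSS.
by apply: eq_integrable => // x _ /=; congr _%:E; rewrite -/(S x); ring.
Qed.

Lemma error_bound kappa K f u uN j N : 1 < alpha -> alpha < 2 ->
  0 < alpha - beta -> 0 < beta -> 0 < K -> 0 < kappa ->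
  kappa <= (sin (pi * alpha) / (sin (pi * (alpha - beta)) + sin (pi * beta))) ^+ 2 ->
  measurable_fun unitI f -> has_Dn j f ->
  L2 (rho (beta - 1 + j%:R) (alpha - beta - 1 + j%:R)) (Dn j f) ->
  (1 <= N)%N -> (j <= N.+1)%N ->
  is_solution alpha r beta (cst K) f u -> is_approx alpha r beta (cst K) f N uN ->
  (\int[mu]_(x in unitI) (rho (- (alpha - beta + 1)) (- (beta + 1)) x * (u x - uN x) ^+ 2)%:E <=
  (K ^- 2 * (4 / (kappa * N%:R ^+ 2 * (N.+1%:R `^ (alpha - 1)) ^+ 2) *
   (j%:R ^+ j / (N%:R * (N%:R + alpha - 1)) ^+ j *
  \int[mu]_(x in unitI) (rho (beta - 1 + j%:R) (alpha - beta - 1 + j%:R) x * Dn j f x ^+ 2))))%:E)%E.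
Proof.
move=> a1 a2 a0 b0 K0 k0 hk mf hD L2D N1 jN [q [c2 [Hq Hc ->]]] [c2' Hc' ->].
have Kn0 : K != 0 by rewrite gt_eqF.
have iq := integrable_q a0 b0 _ _ Hq.
have iN := integrable_qN (r := r) a0 b0 f N.
(* With equal constants the k-terms cancel in u - u_N, leaving only the integral of q - q_N. *)
have -> : c2' = c2.
  rewrite (is_cN2E a0 b0 _ _ _ Kn0 iq Hc) (is_cN2E a0 b0 _ _ _ Kn0 iN Hc').
  by rewrite (integral_q a0 b0 _ _ _ Hq N1).
case: N N1 jN iN Hc' => // N N1 jN iN _.
apply: (fatou_sqr_weighted _ (fun m x => K^-1 * approximant f N m x)).
- exact: measurable_rho.
- by move=> x _; exact: rho_ge0.
- move=> m; apply: measurable_funM => //; apply: measurable_integrableR.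
  apply: (integrable_lincomb (rho (alpha - beta + 1) (beta + 1))
    (fun k => jacobiG (N + k) (alpha - beta + 1) (beta + 1))
    (fun k => c alpha beta f (N + k).+1 / (N + k).+1%:R)) => k _.
  by apply: integrable_rho_jacobiG; lra.
- by move=> x xI; exact: error_cvg.
- move=> m; rewrite integral_approximant// lee_fin ler_wpM2l ?invr_ge0 ?sqr_ge0//.
  have := energy_tail_bound _ _ _ _ _ m a1 a0 b0 mf hD L2D N1 jN.
  set T := 4 / _; have T0 : 0 <= T.
    by rewrite divr_ge0// mulr_ge0 ?sqr_ge0// mulr_ge0 ?sqr_ge0// ltW.
  move=> h; apply: le_trans (ler_wpM2l T0 h).
  rewrite big_distrr/=; apply: ler_sum => k _.
  apply: solution_term_bound => //.
  by rewrite ltnS leq_addr.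
Qed.

End error_bound.

Theorem corollary5p1 (R : realType) (r K : R) (j : nat) (mu alpha0 : R)
  (hr : 2^-1 <= r <= 1) (hK : 0 < K) (hj : (1 <= j)%N)
  (hmu : 0 <= mu <= j%:R) (halpha0 : 1 < alpha0) :
  exists2 C : R, 0 < C &
    forall (alpha beta : R) (f u uN : R -> R) (N : nat),
      1 < alpha < 2 -> (r = 2^-1 -> alpha0 <= alpha) ->
      is_beta alpha r beta ->
      L2 (rho (beta - 1) (alpha - beta - 1)) f ->
      has_Dn j f ->
      L2 (rho (beta + j%:R - 1) (alpha - beta + j%:R - 1)) (Dn j f) ->
      (1 <= N)%N -> (j <= N.+1)%N ->
      is_solution alpha r beta (cst K) f u ->
      is_approx alpha r beta (cst K) f N uN ->
      (wnorm (rho (- (alpha - beta + 1)) (- (beta + 1))) (u \- uN)%R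
       <= (C * N%:R^-1 * N.+1%:R `^ (- (alpha - 1))
           * (N%:R * (N%:R + alpha - 1)) `^ (- (j%:R / 2)))%:E
          * seminorm j (beta - 1) (alpha - beta - 1) f)%E.
Proof.
have /andP[r2 r1] := hr.
have [kappa k0 hkappa] := sin_quotient_lower r alpha0 r2 r1 halpha0.
have j0 : 0 < j%:R :> R by rewrite ltr0n.
(* The square root of K^-2 (4/kappa) j^j, the part of the squared bound that is free of N and
   alpha. *)
exists (2 / (K * Num.sqrt kappa) * Num.sqrt (j%:R ^+ j)).
  by rewrite mulr_gt0 ?sqrtr_gt0 ?exprn_gt0// divr_gt0// mulr_gt0 ?sqrtr_gt0.
move=> alpha beta f u uN N /andP[a1 a2] hal hb L2f hD L2D N1 jN hu huN.
have [/andP[b_ge b_le] _] := hb.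
have b0 : 0 < beta by lra.
have a0 : 0 < alpha - beta.
  rewrite subr_gt0; lra.
have hk := hkappa alpha beta a2 hal hb.
have eb : beta + j%:R - 1 = beta - 1 + j%:R by ring.
have ea : alpha - beta + j%:R - 1 = alpha - beta - 1 + j%:R by ring.
rewrite eb ea in L2D.
have := error_bound _ _ _ _ _ _ _ a1 a2 a0 b0 hK k0 hk L2f.1 hD L2D N1 jN hu huN.
have iD := integrable_fin_num measurable_unitI (L2_integrable_sqr _ _ _ L2D).
(* The semi-norm is finite by hypothesis, so the comparison can be carried out in the reals. *)
rewrite /seminorm /wnorm -(fineK iD) -[fine _]/(Rintegral _ _ _).
set I := Rintegral _ _ _ => hB.
have I0 : 0 <= I by apply: Rintegral_ge0 => x _; rewrite mulr_ge0 ?rho_ge0 ?sqr_ge0.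
have E0 : (0 <= \int[lebesgue_measure]_(x in unitI)
    (rho (- (alpha - beta + 1)) (- (beta + 1)) x * (u x - uN x) ^+ 2)%:E)%E.
  by apply: integral_ge0 => x _; rewrite lee_fin mulr_ge0 ?rho_ge0 ?sqr_ge0.
have := hB; rewrite -(lee_sqrt _ (le_trans E0 hB)) => /le_trans; apply.
rewrite /= -EFinM lee_fin.
have N0 : 0 < N%:R :> R by rewrite ltr0n.
have : 0 < N%:R * (N%:R + alpha - 1) by rewrite mulr_gt0//; lra.
move: (N%:R * (N%:R + alpha - 1)) => Y Y0.
set P := N.+1%:R `^ (alpha - 1); have P0 : 0 < P by rewrite powR_gt0.
set T := (X in _ <= X).
have sk0 : 0 < Num.sqrt kappa by rewrite sqrtr_gt0.
have T0 : 0 <= T.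
  rewrite /T !mulr_ge0 ?powR_ge0 ?sqrtr_ge0 ?invr_ge0 ?mulr_ge0 ?ltW//.
(* The squared bound is exactly the square of the claimed one, and T >= 0 selects the root. *)
suff -> : K ^- 2 * (4 / (kappa * N%:R ^+ 2 * P ^+ 2) * (j%:R ^+ j / Y ^+ j * I)) = T ^+ 2.
  by rewrite sqrtr_sqr ger0_norm.
have eY : (Y `^ (- (j%:R / 2))) ^+ 2 = (Y ^+ j)^-1.
  rewrite -powR_mulrn ?powR_ge0// -powRrM mulNr divfK//.
  by rewrite powRN powR_mulrn ?ltW.
rewrite /T !exprMn eY !sqr_sqrtr ?exprn_ge0 ?(ltW j0)// powRN -/P.
rewrite !exprVn exprMn sqr_sqrtr ?(ltW k0)//.
by field; rewrite ?gt_eqF ?exprn_gt0.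
Qed.
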